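(* Let ${\cal S}$ be the set of triples $(T,X,Y)$ (a tree $T$ with vertex sets $X,Y$) defined semantically in the context via minimum weak Roman dominating functions, and let ${\cal T}$ be the set of triples generated from $(K_1,\emptyset,\emptyset)$ and $(K_1,V(K_1),V(K_1))$ by Operations 1 to 5 as defined in the context. Then ${\cal S}={\cal T}$.
   Context: All graphs are finite, simple, and undirected. For a positive integer $k$, $[k]=\{1,\ldots,k\}$. $N_T(v)$ is the neighborhood of $v$ in $T$. **Functions.** Let $G$ be a graph and $X\subseteq V(G)$. The weight of $f:V(G)\to\{0,1,2\}$ is $\sum_{u\in V(G)}f(u)$. For distinct vertices $u,v$, $f_{v\to u}$ is the function with $f_{v\to u}(u)=f(u)+1$, $f_{v\to u}(v)=f(v)-1$, and $f_{v\to u}(x)=f(x)$ for all other $x$. A set $D\subseteq V(G)$ is $X$-dominating if every vertex in $X\setminus D$ has a neighbor in $D$. A $(G,X)$-RDF is a function $f:V(G)\to\{0,1,2\}$ such that every $u\in X$ with $f(u)=0$ has a neighbor $v$ with $f(v)=2$. A $(G,X)$-WRDF is a function $g:V(G)\to\{0,1,2\}$ such that every $u\in X$ with $g(u)=0$ has a neighbor $v$ with $g(v)\ge1$ such that $\{x\in V(G):g_{v\to u}(x)\ge1\}$ is $X$-dominating. A $(G,X)$-WRDF is minimum if it has minimum weight among all $(G,X)$-WRDFs. **The set ${\cal S}$.** ${\cal S}$ is the set of all triples $(T,X,Y)$ such that: $T$ is a tree and $X,Y\subseteq V(T)$; every minimum $(T,X)$-WRDF is a $(T,X)$-RDF; and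 $Y$ is the set of all vertices $u$ of $T$ for which there is some minimum $(T,X)$-WRDF $g$ such that either $g(u)\ge1$, or $g(u)=0$ and $u$ has a neighbor $v$ with $g(v)\ge1$ such that $\{x\in V(T):g_{v\to u}(x)\ge1\}$ is $X$-dominating. (The Roman domination number strongly equals the weak Roman domination number for a tree $T$, i.e. every minimum $(T,V(T))$-WRDF is a $(T,V(T))$-RDF, if and only if $(T,V(T),V(T))\in{\cal S}$.) **The operations.** Let $(T,X,Y)$ be such that $T$ is a tree, $X,Y\subseteq V(T)$, and $X\subseteq Y$. A triple $(T^+,X^+,Y^+)$ arises by applying the respective operation to $(T,X,Y)$ in the following situations. Operation 1: there is a vertex $u$ of $T$ with $u\notin Y$; $T^+$ arises from $T$ by adding one new vertex $v$ and the edge $uv$; $X^+=X$; $Y^+=Y$. Operation 2: there is a vertex $u$ of $T$ with $u\notin Y$; $T^+$ arises from $T$ by adding three new vertices $v,w_1,w_2$ and the edges $uv,vw_1,vw_2$; $X^+$ is either $X\cup\{u,w_1,w_2\}$ or $X\cup\{u,v,w_1,w_2\}$; $Y^+=Y\cup\{u,v,w_1,w_2\}$. Operation 3: there is a vertex $u$ of $T$ with $u\notin X$; $T^+$ arises from $T$ by adding four new vertices $v,w_1,w_2,w_3$ and the edges $uv,vw_1,vw_2,vw_3$; $X^+$ is one of $X\cup\{w_1,w_2,w_3\}$, $X\cup\{u,w_1,w_2,w_3\}$, $X\cup\{v,w_1,w_2,w_3\}$, $X\cup\{u,v,w_1,w_2,w_3\}$; $Y^+=Y\cup\{u,v,w_1,w_2,w_3\}$.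 Operations 4 and 5 require the following configuration in $(T,X,Y)$: $v$ is a vertex of $T$ with $N_T(v)=\{u,w_1,\ldots,w_k\}$ (these $k+1$ vertices being distinct); for $i\in[k]$, $W_i$ is the vertex set of the component of $T-v$ containing $w_i$; for some $\ell\in[k]$, $W_i\cap X=\{w_i\}$ for $i\in[\ell]$ and $W_j\cap X=\emptyset$ for $j\in[k]\setminus[\ell]$; and either ($\ell=2$, $u\in X$, $u,v\in Y$, and $W_i\cap Y=\{w_i\}$ for all $i\in[k]$) or ($\ell\ge3$, $u,v\in Y$, and $W_i\cap Y=\{w_i\}$ for all $i\in[k]$). Operation 4: given such a configuration, $T^+$ arises from $T$ by adding one new vertex $v^*$ and the edge $vv^*$; $X^+$ is either $X$ or $X\cup\{v^*\}$; $Y^+=Y\cup\{v^*\}$. Operation 5: given such a configuration, $T^+$ arises from $T$ by adding one new vertex $v^*$ and the edge $w_iv^*$ for some $i\in[k]$; $X^+=X$; $Y^+=Y$. **The set ${\cal T}$.** ${\cal T}$ is the smallest set of triples that contains $(K_1,\emptyset,\emptyset)$ and $(K_1,V(K_1),V(K_1))$, where $K_1$ is the tree of order $1$ (any one-vertex tree; triples are considered up to isomorphism), and that contains every triple arising by applying Operation $i$, for some $i\in[5]$, to a triple in ${\cal T}$. *)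

(* Defs.v *)
From mathcomp Require Import all_boot.

Set Implicit Arguments.
Unset Strict Implicit.
Unset Printing Implicit Defensive.

Record sgraph := SGraph {
  svertex :> finType;
  sedge : rel svertex;
  sedge_sym : symmetric sedge;
  sedge_irr : irreflexive sedge }.

Definition nbh (G : sgraph) (v : G) : {set G} := [set x | sedge v x].

Definition acyclic (G : sgraph) : Prop :=
  forall c : seq G, 2 < size c -> ~ ucycle (@sedge G) c.

Definition is_tree (G : sgraph) : Prop :=
  [/\ 0 < #|G|, forall x y : G, connect (@sedge G) x y & acyclic G].

(* Vertex set of the component of G - v containing w, for w != v. *)
Definition comp_del (G : sgraph) (v w : G) : {set G} :=
  [set x | connect (fun a b => [&& a != v, b != v & sedge a b]) w x].

Section Domination.

Variables (G : sgraph) (X : {set G}).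

Definition dominating (D : {set G}) : bool :=
  [forall u in X :\: D, exists v in D, sedge u v].

Definition weight (f : {ffun G -> 'I_3}) : nat := \sum_(u : G) f u.

(* f_{v -> u}; nat-valued, since moving a unit may leave {0,1,2}. The truncated
   subtraction is harmless: it is only used when f v >= 1. *)
Definition move (f : {ffun G -> 'I_3}) (v u : G) : G -> nat :=
  fun x => if x == u then (f x).+1 else if x == v then (f x).-1 else f x.

Definition rdf (f : {ffun G -> 'I_3}) : bool :=
  [forall u in X, (f u == 0 :> nat) ==>
     [exists v, sedge u v && (f v == 2 :> nat)]].

Definition defended (g : {ffun G -> 'I_3}) (u : G) : bool :=
  [exists v, [&& sedge u v, 1 <= g v &
     dominating [set x | 1 <= move g v u x]]].

Definition wrdf (g : {ffun G -> 'I_3}) : bool :=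
  [forall u in X, (g u == 0 :> nat) ==> defended g u].

Definition min_wrdf (g : {ffun G -> 'I_3}) : bool :=
  wrdf g && [forall h, wrdf h ==> (weight g <= weight h)].

End Domination.

Record triple := Triple {
  tgraph : sgraph;
  tX : {set tgraph};
  tY : {set tgraph} }.

Definition calS (t : triple) : Prop :=
  [/\ is_tree (tgraph t),
      forall g, min_wrdf (tX t) g -> rdf (tX t) g &
      tY t = [set u | [exists g, min_wrdf (tX t) g &&
                [|| 1 <= g u | (g u == 0 :> nat) && defended (tX t) g u]]]].

Definition triple_iso (t t' : triple) : Prop :=
  exists f : tgraph t -> tgraph t',
    [/\ bijective f,
        forall x y, sedge (f x) (f y) = sedge x y,
        f @: tX t = tX t' &
        f @: tY t = tY t'].

Section Extensions.

Variables (G : sgraph) (u : G).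

(* The new vertex is None; it is joined to u. *)
Definition leaf_rel : rel (option G) := fun a b =>
  match a, b with
  | Some x, Some y => sedge x y
  | Some x, None | None, Some x => x == u
  | None, None => false
  end.

Lemma leaf_sym : symmetric leaf_rel.
Proof. by move=> [x|] [y|] //=; exact: sedge_sym. Qed.

Lemma leaf_irr : irreflexive leaf_rel.
Proof. by move=> [x|] //=; exact: sedge_irr. Qed.

Definition add_leaf : sgraph :=
  @SGraph (option G) leaf_rel leaf_sym leaf_irr.

(* The new vertices are v = inr None, joined to u, and the n vertices
   w_i = inr (Some i), joined to v. *)
Definition star_rel (n : nat) : rel (G + option 'I_n) := fun a b =>
  match a, b with
  | inl x, inl y => sedge x y
  | inl x, inr None | inr None, inl x => x == u
  | inr None, inr (Some _) | inr (Some _), inr None => true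
  | _, _ => false
  end.

Lemma star_sym n : symmetric (@star_rel n).
Proof. by move=> [x|[i|]] [y|[j|]] //=; exact: sedge_sym. Qed.

Lemma star_irr n : irreflexive (@star_rel n).
Proof. by move=> [x|[i|]] //=; exact: sedge_irr. Qed.

Definition add_star (n : nat) : sgraph :=
  @SGraph (G + option 'I_n)%type (@star_rel n) (@star_sym n) (@star_irr n).

Definition old_leaf (x : G) : add_leaf := Some x.
Definition new_leaf : add_leaf := None.

Definition old_star (n : nat) (x : G) : add_star n := inl x.
Definition center (n : nat) : add_star n := inr None.
Definition rays (n : nat) : {set add_star n} :=
  [set (inr (Some i) : add_star n) | i : 'I_n].

End Extensions.

(* Here w_1, ..., w_k are indexed from 0, so that [l] becomes {i | i < l}. *)
Definition config (G : sgraph) (X Y : {set G}) (v u : G)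
    (k : nat) (w : 'I_k -> G) : Prop :=
  [/\ injective w,
      (forall i, w i != u),
      nbh v = u |: [set w i | i : 'I_k] &
      exists l : nat,
        [/\ 1 <= l <= k,
            (forall i : 'I_k, i < l -> comp_del v (w i) :&: X = [set w i]),
            (forall i : 'I_k, l <= i -> comp_del v (w i) :&: X = set0) &
            [/\ l = 2, u \in X, u \in Y, v \in Y &
                forall i, comp_del v (w i) :&: Y = [set w i]]
            \/
            [/\ 3 <= l, u \in Y, v \in Y &
                forall i, comp_del v (w i) :&: Y = [set w i]]]].

Inductive operation (G : sgraph) (X Y : {set G}) : triple -> Prop :=
| Operation1 (u : G) :
    u \notin Y ->
    operation X Y
      (@Triple (add_leaf u) (old_leaf u @: X) (old_leaf u @: Y))
| Operation2 (u : G) (X' : {set add_star u 2}) :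
    u \notin Y ->
    X' = old_star u 2 @: (u |: X) :|: rays u 2 \/
    X' = old_star u 2 @: (u |: X) :|: (center u 2 |: rays u 2) ->
    operation X Y
      (@Triple (add_star u 2) X'
         (old_star u 2 @: (u |: Y) :|: (center u 2 |: rays u 2)))
| Operation3 (u : G) (X' : {set add_star u 3}) :
    u \notin X ->
    [\/ X' = old_star u 3 @: X :|: rays u 3,
        X' = old_star u 3 @: (u |: X) :|: rays u 3,
        X' = old_star u 3 @: X :|: (center u 3 |: rays u 3) |
        X' = old_star u 3 @: (u |: X) :|: (center u 3 |: rays u 3)] ->
    operation X Y
      (@Triple (add_star u 3) X'
         (old_star u 3 @: (u |: Y) :|: (center u 3 |: rays u 3)))
| Operation4 (v u : G) (k : nat) (w : 'I_k -> G) (X' : {set add_leaf v}) :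
    config X Y v u w ->
    X' = old_leaf v @: X \/ X' = new_leaf v |: old_leaf v @: X ->
    operation X Y
      (@Triple (add_leaf v) X' (new_leaf v |: old_leaf v @: Y))
| Operation5 (v u : G) (k : nat) (w : 'I_k -> G) (i : 'I_k) :
    config X Y v u w ->
    operation X Y
      (@Triple (add_leaf (w i)) (old_leaf (w i) @: X) (old_leaf (w i) @: Y)).

Definition no_edge : rel unit := fun _ _ => false.

Lemma no_edge_sym : symmetric no_edge. Proof. by []. Qed.
Lemma no_edge_irr : irreflexive no_edge. Proof. by []. Qed.

Definition K1 : sgraph := SGraph no_edge_sym no_edge_irr.

(* calT_iso: triples are taken up to isomorphism. *)
Inductive calT : triple -> Prop :=
| calT_empty : calT (@Triple K1 set0 set0)
| calT_full : calT (@Triple K1 setT setT)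
| calT_op (G : sgraph) (X Y : {set G}) (t' : triple) :
    calT (@Triple G X Y) -> is_tree G -> X \subset Y ->
    operation X Y t' -> calT t'
| calT_iso (t t' : triple) : triple_iso t t' -> calT t -> calT t'.

(* Main.v *)
Require Import Defs.
From mathcomp Require Import all_boot.
From mathcomp Require Import zify.

Set Implicit Arguments.
Unset Strict Implicit.
Unset Printing Implicit Defensive.

(** Both sets are characterized by a certificate: either T is a single vertex
    and X = Y = V(T), or there is a set C of vertices with X contained in N[C],
    Y = N[C], and such that every v in C has at least three private neighbors,
    that is, vertices of X outside C whose only neighbor in C is v.

    Given such a C, root T and cut it into blocks, one for each v in C, made of
    the vertices whose nearest ancestor in C is v. A weak Roman dominating
    function has weight at least 2 on each block, and going down from the root
    one sees that weight exactly 2|C| forces the function with value 2 on C and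
    0 elsewhere, which is therefore the only minimum one. Conversely, if all
    minimum functions are Roman, moving weight locally around a vertex shows
    that the value 1 does not occur and that the vertices of value 2 form a
    certificate.

    Each operation preserves certificates. In the other direction, root T
    outside C and take a deepest v in C: either a leaf below v can be removed
    (Operations 1, 4, 5), or v has just two or three children, all of them
    leaves in X, and v is removed together with them (Operations 2, 3). *)

(** * Rooted trees *)

Section RootedTrees.

Variable G : sgraph.
Implicit Types (d : G -> nat) (r x y z : G).

(** The levels of a rooted forest, in which the only lower neighbor of a vertex is its parent. Only
    comparisons of levels matter, not their exact values, so a level function pulled back along an
    embedding can qualify again. *)
Definition layered d : Prop :=
  (forall x y, sedge x y -> d x != d y) /\
  (forall x y z, sedge x y -> sedge x z -> d y < d x -> d z < d x -> y = z).

Definition rooted r d : Prop :=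
  layered d /\ forall x, x != r -> exists2 y, sedge x y & d y < d x.

(** A vertex of maximum level on a cycle would have two distinct lower neighbors. *)
Lemma layered_acyclic d : layered d -> acyclic G.
Proof.
move=> [dE dU] c c_gt2 /andP[cyc unq].
have [x0 x0c] : exists x, x \in c.
  by case: c c_gt2 {cyc unq} => // x c _; exists x; rewrite mem_head.
case: (arg_maxnP d x0c) => x xc xmax.
have [i s eqs] := rot_to xc.
have szs : 2 < size (x :: s) by rewrite -eqs size_rot.
have max_s y : y \in x :: s -> d y <= d x.
  by rewrite -eqs mem_rot; apply: xmax.
move: unq cyc; rewrite -(rot_uniq i) -(rot_cycle i) eqs.
case: s szs {eqs} max_s => [|y s] // szs max_s; case/lastP: s szs max_s => // s z _ max_s.
rewrite /= rcons_path last_rcons mem_rcons inE negb_or.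
move=> /and3P[_ /andP[y_z _] _] /and3P[xy _ zx].
move: zx; rewrite sedge_sym => xz.
have lt w : sedge x w -> w \in [:: x, y & rcons s z] -> d w < d x.
  by move=> xw /max_s; rewrite ltn_neqAle eq_sym dE.
case/eqP: y_z; apply: (dU x) => //; apply: lt => //.
  by rewrite !inE eqxx orbT.
by rewrite !inE mem_rcons mem_head !orbT.
Qed.

Lemma rooted_tree r d : rooted r d -> is_tree G.
Proof.
move=> [lay low]; split; last exact: layered_acyclic lay.
  by apply/card_gt0P; exists r.
have sym := sym_connect_sym (@sedge_sym G).
suff toroot x : connect (@sedge G) x r.
  by move=> x y; apply: connect_trans (toroot x) _; rewrite sym.
have [n] := ubnP (d x); elim: n x => // n IHn x lt_n.
have [-> // | /low[y xy lt_y]] := eqVneq x r.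
by apply: connect_trans (connect1 xy) (IHn y _); lia.
Qed.

(** Here [d] is the distance from [r]. Each vertex other than [r] selects one lower neighbor; the
    selected edges already connect the graph, so by acyclicity there are no other edges. *)
Lemma tree_rooted r : is_tree G -> exists d, rooted r d.
Proof.
move=> [_ conn acyc].
have len_ex x : exists n,
    [exists p : n.-tuple G, path (@sedge G) r p && (last r p == x)].
  have /connectP[p rp ->] := conn r x.
  by exists (size p); apply/existsP; exists (in_tuple p); rewrite rp eqxx.
pose d x := ex_minn (len_ex x).
have d_le p : path (@sedge G) r p -> d (last r p) <= size p.
  move=> rp; rewrite /d; case: ex_minnP => m _; apply.
  by apply/existsP; exists (in_tuple p); rewrite rp eqxx.
have low x : x != r -> exists2 y, sedge x y & d y < d x.
  move=> x_r; rewrite [d x]/d; case: ex_minnP => m /existsP[p /andP[rp /eqP lx]] _.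
  have : size p = m by rewrite size_tuple.
  case/lastP: (tval p) rp lx => [_ /= eq_rx|q y].
    by rewrite eq_rx eqxx in x_r.
  rewrite rcons_path last_rcons size_rcons => /andP[rq qy] <- <-.
  by exists (last r q); [rewrite sedge_sym | rewrite ltnS d_le].
exists d; split=> //.
pose par x := odflt x [pick y | sedge x y & d y < d x].
have parP x : x != r -> sedge x (par x) && (d (par x) < d x).
  move=> /low[y xy lt_y]; rewrite /par; case: pickP => //= /(_ y).
  by rewrite xy lt_y.
pose f : rel G := fun a b => sedge a b && ((b == par a) || (a == par b)).
have fsym : symmetric f by move=> a b; rewrite /f sedge_sym orbC.
have toroot x : connect f x r.
  have [n] := ubnP (d x); elim: n x => // n IHn x lt_n.
  have [-> // | /parP/andP[xy lt_y]] := eqVneq x r.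
  apply: connect_trans (IHn (par x) _); last lia.
  by apply: connect1; rewrite /f xy eqxx.
have edge_par x y : sedge x y -> f x y.
  move=> xy; apply: contraT => nfxy.
  have /connectP[p0 fp0 ly0] : connect f x y.
    apply: connect_trans (toroot x) _.
    by rewrite (sym_connect_sym fsym).
  (* A simple path of selected edges from [x] to [y] has length at least two if [xy] is not
     selected, and [xy] closes it to a cycle. *)
  case/shortenP: fp0 ly0 => p fp unq _ ly.
  case: (acyc (x :: p)).
    case: p ly fp {unq} => [|z [|]] //= eqy; first by rewrite eqy sedge_irr in xy.
    by rewrite -eqy (negPf nfxy).
  apply/andP; split=> //; rewrite /= rcons_path -ly sedge_sym xy andbT.
  by apply: sub_path fp => a b /andP[].
have lt_par x : x != r -> d (par x) < d x by move/parP/andP=> [].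
(* As [d r] is 0, no neighbor of [r] is lower and [odflt] returns its default. *)
have par_r : par r = r.
  rewrite /par; case: pickP => //= y /andP[_].
  by have := d_le [::] isT => /=; lia.
have dpar x y : sedge x y -> y == par x -> d y < d x.
  move=> xy /eqP ey; apply: (eq_ind_r (fun w => d w < d x) _ ey).
  by apply: lt_par; apply: contraTneq xy => xr; rewrite ey xr par_r sedge_irr.
split=> [x y xy|x y z xy xz lty ltz].
  have /andP[_ /orP[]] := edge_par _ _ xy.
    by move/(dpar _ _ xy); lia.
  by rewrite sedge_sym in xy; move/(dpar _ _ xy); lia.
have up w : sedge x w -> d w < d x -> w = par x.
  move=> xw ltw; have /andP[_ /orP[/eqP//|]] := edge_par _ _ xw.
  by rewrite sedge_sym in xw; move/(dpar _ _ xw); lia.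
by rewrite (up y) // (up z).
Qed.

End RootedTrees.

(** * Certificates *)

Section Certificates.

Variable G : sgraph.
Implicit Types (X C : {set G}) (g : {ffun G -> 'I_3}).

Definition closed_nbh C : {set G} := [set x | (x \in C) || [exists c in C, sedge x c]].

Definition private X C v : {set G} := [set y in X :\: C | nbh y :&: C == [set v]].

Definition certificate X C : Prop :=
  X \subset closed_nbh C /\ forall v, v \in C -> 2 < #|private X C v|.

Definition two_on C : {ffun G -> 'I_3} :=
  [ffun x => if x \in C then ord_max else ord0].

Lemma two_onE C x : two_on C x = (x \in C).*2 :> nat.
Proof. by rewrite ffunE; case: (x \in C). Qed.

Lemma closed_nbhP C x :
  reflect (x \in C \/ exists2 c, c \in C & sedge x c) (x \in closed_nbh C).
Proof.
by rewrite inE; apply: (iffP orP) => -[]; auto=> /exists_inP; right.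
Qed.

Lemma privateP X C v y :
  reflect [/\ y \in X, y \notin C, sedge y v, v \in C
            & forall c, c \in C -> sedge y c -> c = v]
          (y \in private X C v).
Proof.
rewrite !inE; apply: (iffP andP) => [[/andP[yC yX] /eqP eqv]|[yX yC yv vC unv]].
  have /setIP[] : v \in nbh y :&: C by rewrite eqv set11.
  rewrite inE => yv vC; split=> // c cC yc.
  by apply/set1P; rewrite -eqv !inE yc.
split; first by rewrite yC.
apply/eqP/setP=> c; rewrite !inE; apply/andP/eqP => [[yc cC]|-> //].
exact: unv.
Qed.

Lemma dominatingP X (D : {set G}) :
  reflect (forall x, x \in X -> x \notin D -> exists2 v, v \in D & sedge x v)
          (dominating X D).
Proof.
apply: (iffP forall_inP) => dom x.
  by move=> xX xD; apply/exists_inP/dom; rewrite inE xX xD.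
by case/setDP=> xX xD; apply/exists_inP; apply: dom.
Qed.

Lemma defendedP X g u :
  reflect (exists v, [/\ sedge u v, 1 <= g v &
             forall x, x \in X -> move g v u x = 0 ->
               exists2 z, 1 <= move g v u z & sedge x z])
          (defended X g u).
Proof.
apply: (iffP existsP) => -[v].
  case/and3P=> uv gv /dominatingP dom; exists v; split=> // x xX x0.
  by have [|z] := dom x xX; rewrite ?inE ?x0 //; exists z.
move=> [uv gv dom]; exists v; rewrite uv gv; apply/dominatingP=> x xX.
rewrite inE -leqNgt leqn0 => /eqP x0.
by have [z z1 xz] := dom x xX x0; exists z; rewrite ?inE.
Qed.

Lemma wrdfP X g :
  reflect (forall u, u \in X -> g u = 0 :> nat -> defended X g u) (wrdf X g).
Proof.
apply: (iffP forall_inP) => W u uX; first by move=> u0; have := W u uX; rewrite u0 eqxx.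
by apply/implyP=> /eqP; apply: W.
Qed.

Lemma rdfP X g :
  reflect (forall u, u \in X -> g u = 0 :> nat ->
             exists2 v, sedge u v & g v = 2 :> nat) (rdf X g).
Proof.
apply: (iffP forall_inP) => W u uX.
  move=> u0; have := W u uX; rewrite u0 eqxx => /existsP[v /andP[uv /eqP]].
  by exists v.
apply/implyP=> /eqP u0; have [v uv v2] := W u uX u0.
by apply/existsP; exists v; rewrite uv v2 /=.
Qed.

Lemma min_wrdfP X g :
  reflect (wrdf X g /\ forall h, wrdf X h -> weight g <= weight h) (min_wrdf X g).
Proof.
apply: (iffP andP) => -[W min]; split=> //.
  by move=> h; apply/implyP/(forallP min).
by apply/forallP=> h; apply/implyP/min.
Qed.

(** A vertex of value 2 stays positive after giving up a unit, so the positive set does not shrink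
    and still dominates [X]. *)
Lemma wrdf_from_rdf X g : rdf X g -> wrdf X g.
Proof.
move=> /rdfP R; apply/wrdfP=> u uX u0; have [v uv v2] := R u uX u0.
apply/defendedP; exists v; split=> //; first by rewrite v2.
have pos z : 0 < g z -> 0 < move g v u z.
  by rewrite /move; case: eqP => // _; case: eqP => [->|//]; rewrite v2.
move=> x xX x0; have [|z xz z2] := R x xX; last by exists z; rewrite ?pos ?z2.
by apply/eqP; rewrite -leqn0 leqNgt; apply: contra_eqN x0 => /pos; case: (move _ _ _ _).
Qed.

End Certificates.

(** * A certificate determines the unique minimum function *)

Section StrongCertificates.

Variables (G : sgraph) (X C : {set G}).
Implicit Types (x y z v w : G) (g : {ffun G -> 'I_3}).

Lemma two_on_rdf : X \subset closed_nbh C -> rdf X (two_on C).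
Proof.
move=> XC; apply/rdfP=> u uX; rewrite two_onE.
case/closed_nbhP: (subsetP XC u uX) => [-> //|[c cC uc _]].
by exists c; rewrite // two_onE cC.
Qed.

Lemma weight_two_on : weight (two_on C) = \sum_v (v \in C).*2.
Proof. by apply: eq_bigr => v _; rewrite two_onE. Qed.

Lemma defended_two_on v : X \subset closed_nbh C -> v \notin C ->
  defended X (two_on C) v = [exists c in C, sedge v c].
Proof.
move=> XC vC; apply/defendedP/exists_inP => [[c [vc]]|[c cC vc]].
  by rewrite two_onE; case: (boolP (c \in C)) => // cC _ _; exists c.
have inC z : z \in C -> 0 < move (two_on C) c v z.
  move=> zC; rewrite /move !two_onE zC; case: eqP => // _.
  by case: eqP.
exists c; split; rewrite ?two_onE ?cC // => x xX x0.
case/closed_nbhP: (subsetP XC x xX) => [/inC|[z zC xz]]; first by rewrite x0.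
by exists z; rewrite ?inC.
Qed.

Variable d : G -> nat.
Hypothesis lay : layered d.

Let par x := odflt x [pick y | sedge x y & d y < d x].

Let parE x y : sedge x y -> d y < d x -> par x = y.
Proof.
move=> xy yx; rewrite /par; case: pickP => [z /andP[xz zx]|/(_ y)] /=.
  exact: (lay.2 x).
by rewrite xy yx.
Qed.

Let par_lt x : par x != x -> sedge x (par x) && (d (par x) < d x).
Proof. by rewrite /par; case: pickP => //= _; rewrite eqxx. Qed.

Let edge_par x y : sedge x y -> par x = y /\ d y < d x \/ par y = x /\ d x < d y.
Proof.
move=> xy; case: (ltngtP (d x) (d y)) (lay.1 _ _ xy) => // lt _; [right|left]; split=> //.
  by apply: parE; rewrite // sedge_sym.
exact: parE.
Qed.

(* [top x] is the nearest ancestor of [x] in [C], or the root of the component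
   of [x] when there is none; the fibers of [top] over [C] are the blocks. *)
Let up x := if x \in C then x else par x.
Let top x := iter (d x) up x.

Let up_lt x : up x = x \/ d (up x) < d x.
Proof.
rewrite /up; case: ifP => _; first by left.
by have [->|/par_lt/andP[]] := eqVneq (par x) x; [left|right].
Qed.

(** A step of [up] that moves lowers the level, so [d x] steps always reach a fixed point. *)
Let top_iter n x : d x <= n -> iter n up x = top x.
Proof.
have [m] := ubnP (d x); elim: m n x => // m IHm n x lt_m le_n.
have fix_up y k : up y = y -> iter k up y = y by move=> e; elim: k => //= k ->.
have [fx|lt] := up_lt x; first by rewrite /top !fix_up.
rewrite /top; case: (d x) lt le_n lt_m => // k lt; case: n => // n le_n lt_m.
by rewrite !iterSr !IHm //; lia.
Qed.

Let top_up x : top (up x) = top x.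
Proof.
rewrite -(@top_iter (d x).+1 x) // iterSr top_iter //.
by case: (up_lt x) => [->|/ltnW].
Qed.

Let top_C x : x \in C -> top x = x.
Proof.
by move=> xC; rewrite /top; elim: (d x) => //= n ->; rewrite /up xC.
Qed.

Let top_child x y : sedge x y -> d y < d x -> x \notin C -> top x = top y.
Proof. by move=> xy yx xC; rewrite -top_up /up (negPf xC) (parE xy). Qed.

Let top_le x : d (top x) <= d x.
Proof.
suff le n : d (iter n up x) <= d x by apply: le.
elim: n => //= n IHn; set y := iter _ _ _ in IHn *.
by case: (up_lt y) => [->|] //; lia.
Qed.

Variable g : {ffun G -> 'I_3}.
Hypothesis W : wrdf X g.

(** A private neighbor [y] of [v] with this property can be defended from [v] only. *)
Let lonely v y := [forall z, (z == y) || sedge y z && (z != v) ==> (g z == 0 :> nat)].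

Let lonely_self v y : lonely v y -> g y = 0 :> nat.
Proof. by move/forallP/(_ y); rewrite eqxx => /eqP. Qed.

Let lonely_nbr v y z : lonely v y -> sedge y z -> z <> v -> g z = 0 :> nat.
Proof. by move=> /forallP/(_ z) + yz /eqP zv; rewrite yz zv orbT => /eqP. Qed.

Let lonely_defended v y : y \in private X C v -> lonely v y ->
  0 < g v /\ forall x, x \in X -> move g v y x = 0 ->
               exists2 z, 1 <= move g v y z & sedge x z.
Proof.
move=> /privateP[yX _ yv _ _] lon.
have /(wrdfP _ _ W y yX)/defendedP[z [yz gz dom]] := lonely_self lon.
have [ezv|/eqP/(lonely_nbr lon yz)] := eqVneq z v; last by lia.
by rewrite ezv in gz dom.
Qed.

Let no_triangle x y z : sedge x y -> sedge y z -> sedge x z -> False.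
Proof.
move=> xy yz xz; have top_free a b c :
    sedge a b -> sedge a c -> sedge b c -> ~ (d b < d a /\ d c < d a).
  move=> ab ac bc [lb lc]; have eqbc := lay.2 _ _ _ ab ac lb lc.
  by rewrite eqbc sedge_irr in bc.
have := lay.1 _ _ xy; have := lay.1 _ _ yz; have := lay.1 _ _ xz.
have yx : sedge y x by rewrite sedge_sym.
have zy : sedge z y by rewrite sedge_sym.
have zx : sedge z x by rewrite sedge_sym.
by move: (top_free x y z) (top_free y x z) (top_free z x y) => /(_ xy xz yz) ?
  /(_ yx yz xz) ? /(_ zx zy xy) ?; lia.
Qed.

(** If [v] held a single unit, sending it to [y1] would leave [y2] undominated: the neighbors of
    [y2] other than [v] have value 0, and [y1] is not one of them because a forest has no
    triangle. *)
Let two_lonely v y1 y2 : y1 \in private X C v -> y2 \in private X C v ->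
  lonely v y1 -> lonely v y2 -> y1 != y2 -> 1 < g v.
Proof.
move=> P1 P2 L1 L2 y12; have [gv dom] := lonely_defended P1 L1.
case/privateP: P1 P2 => [_ y1C y1v vC _] /privateP[y2X y2C y2v _ _].
rewrite ltn_neqAle gv andbT; apply/eqP=> gv1.
have y2_v : y2 != v by apply: contraNneq y2C => ->.
have m0 : move g v y1 y2 = 0.
  by rewrite /move eq_sym (negPf y12) (negPf y2_v) (lonely_self L2).
have [z] := dom y2 y2X m0; rewrite /move; case: eqP => [-> _ y2y1|_].
  by case: (@no_triangle y1 v y2); rewrite // sedge_sym.
case: eqP => [->|zv gz y2z]; first by rewrite -gv1.
by rewrite (lonely_nbr L2 y2z zv) in gz.
Qed.

Let lonely_card v : g v <= 1 -> #|[set y in private X C v | lonely v y]| <= g v.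
Proof.
move=> gv1; set L := finset _.
have [c1|/card_gt1P[y1 [y2 [/setIdP[P1 L1] /setIdP[P2 L2] y12]]]] := leqP #|L| 1.
  have [-> //|/card_gt0P[y /setIdP[Py Ly]]] := posnP #|L|.
  by apply: leq_trans c1 _; case: (lonely_defended Py Ly).
by have := two_lonely P1 P2 L1 L2 y12; lia.
Qed.

Let kids v := [set y in private X C v | d v < d y].
Let block v := \sum_(z | top z == v) g z.

(** The parent of [v] is the only neighbor that is not below [v]. *)
Let priv_kids v : #|private X C v| <= #|kids v| + 1.
Proof.
rewrite -(cardsID [set y | d v < d y] (private X C v)).
have -> : private X C v :&: [set y | d v < d y] = kids v.
  by apply/setP=> y; rewrite !inE.
rewrite leq_add2l -(cards1 (par v)); apply/subset_leq_card/subsetP=> y.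
rewrite in_setD inE => /andP[dy /privateP[_ _ yv _ _]]; rewrite inE.
by case: (edge_par yv) => [[_]|[-> _] //]; rewrite (negPf dy).
Qed.

(* The closed neighborhoods of distinct children of [v] meet only in [v]. *)
Let block_ge v : v \in C -> #|[set y in kids v | ~~ lonely v y]| + g v <= block v.
Proof.
move=> vC; rewrite /block (bigD1 v) ?top_C //= addnC leq_add2l.
pose S := [set z | [&& top z == v, z != v & 0 < g z]].
have le_S : #|S| <= \sum_(z | (top z == v) && (z != v)) g z.
  rewrite -sum1_card big_mkcond [leqRHS]big_mkcond; apply: leq_sum => z _.
  by rewrite inE; case: (top z == v); case: (z != v) => //=; case: ltnP.
(* Each kid that is not lonely has a vertex of positive weight, other than [v], in its closed
   neighborhood. From that vertex, which is the kid itself or a child of it, [t] recovers the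
   kid. *)
apply: leq_trans le_S; pose t z := if par z == v then z else par z.
apply: leq_trans (leq_imset_card t S); apply/subset_leq_card/subsetP=> y.
move=> /setIdP[/setIdP[/privateP[_ yC yv _ unv] dvy]].
case/forallPn=> z; rewrite negb_imply -lt0n => /andP[zy gz].
have y_v : y != v by apply: contraNneq yC => ->.
apply/imsetP; exists z.
  rewrite inE gz andbT; case/predU1P: zy => [->|/andP[yz zv]].
    by rewrite y_v (top_child yv) // top_C ?eqxx.
  have zC : z \notin C by apply: contra zv => zC; apply/eqP/unv.
  rewrite zv andbT; case: (edge_par yz) => [[e lt]|[e lt]].
    by rewrite (parE yv) // in e; rewrite e eqxx in zv.
  by rewrite (@top_child z y) ?(sedge_sym z) // (top_child yv) // top_C ?eqxx.
case/predU1P: zy => [->|/andP[yz zv]]; rewrite /t; first by rewrite (parE yv) ?eqxx.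
case: (edge_par yz) => [[e lt]|[e lt]].
  by rewrite (parE yv) // in e; rewrite e eqxx in zv.
by rewrite e (negPf y_v).
Qed.

Hypothesis cert : certificate X C.

Let kids_split v :
  #|[set y in kids v | ~~ lonely v y]| + #|[set y in kids v | lonely v y]| = #|kids v|.
Proof.
rewrite addnC -(cardsID [set y | lonely v y] (kids v)); congr (_ + _).
  by apply: eq_card => y; rewrite !inE.
by apply: eq_card => y; rewrite !inE andbC.
Qed.

Let kids_lonely v : [set y in kids v | lonely v y] \subset [set y in private X C v | lonely v y].
Proof. by apply/subsetP=> y /setIdP[/setIdP[yP _] Ly]; rewrite inE yP. Qed.

(** If [g v <= 1], at most [g v] of the at least two kids are lonely. Each other kid accounts for a
    unit of its own, so [g v] makes up for the lonely ones. *)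
Let block_ge2 v : v \in C -> 2 <= block v.
Proof.
move=> vC; have ge := block_ge vC.
case: (leqP (g v) 1) => [gv1|]; last by lia.
have := cert.2 v vC; have := priv_kids v; have := kids_split v.
have := subset_leq_card (kids_lonely v); have := lonely_card gv1; lia.
Qed.

(** Suppose [g v <= 1]. With three kids the count for [block_ge2] already gives 3. With only two,
    the parent of [v] is private and, by assumption, lonely; it uses up one of the [g v] admissible
    lonely vertices, and the count again gives 3. *)
Let block_eq2 v : v \in C -> block v = 2 ->
  (forall p, p \in private X C v -> d p < d v -> lonely v p) -> g v = 2 :> nat.
Proof.
move=> vC b2 lonp; have ge := block_ge vC.
case: (leqP (g v) 1) => [gv1|]; last by have := ltn_ord (g v); lia.
have c3 := cert.2 v vC; have lc := lonely_card gv1; have ks := kids_split v.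
have kl := kids_lonely v; have klc := subset_leq_card kl.
have [sub|/subsetPn[p pP pK]] := boolP (private X C v \subset kids v).
  have := subset_leq_card sub; lia.
have dp : d p < d v.
  case/privateP: (pP) => _ _ pv _ _; case: (edge_par pv) => -[_] //.
  by move=> lt; rewrite inE pP lt in pK.
have : [set y in kids v | lonely v y] \proper [set y in private X C v | lonely v y].
  apply/properP; split=> //; exists p; first by rewrite inE pP lonp.
  by apply: contra pK => /setIdP[].
move/proper_card; have := priv_kids v; lia.
Qed.

Lemma certificate_bound : weight (two_on C) <= weight g.
Proof.
rewrite weight_two_on /weight [leqRHS](partition_big top xpredT) //=.
by apply: leq_sum => v _; case: (boolP (v \in C)) => [/block_ge2|] //.
Qed.

(** Every block must attain its lower bound. Induction on the level of [v] then gives [g v = 2]: if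
    the parent of [v] is private, it and its neighbors other than [v] lie in a common block whose
    top is higher up, and a block with value 2 at its top has nothing left elsewhere, so the parent
    is lonely. *)
Lemma certificate_unique : weight g <= weight (two_on C) -> g = two_on C.
Proof.
rewrite weight_two_on {1}/weight [leqLHS](partition_big top xpredT) //= => le.
have b_eq v : block v = (v \in C).*2.
  have := @leqif_sum _ predT (fun v => (v \in C).*2 == block v) (fun v => (v \in C).*2) block.
  case=> [u _|ge eqs].
    by split=> //; case: (boolP (u \in C)) => [/block_ge2|] //.
  have /eqP : \sum_i (i \in C).*2 = \sum_i block i by apply/eqP; rewrite eqn_leq ge.
  by rewrite eqs => /forallP/(_ v)/eqP.
have zero z : z \notin C -> (top z \in C -> g (top z) = 2 :> nat) -> g z = 0 :> nat.
  move=> zC g2; have := b_eq (top z); rewrite /block (bigD1 z) //=.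
  case: (boolP (top z \in C)) => [tC|_]; last by lia.
  rewrite (bigD1 (top z)) /=; first by rewrite g2 //; lia.
  by rewrite top_C // eqxx; apply: contraNneq zC => <-.
have two v : v \in C -> g v = 2 :> nat.
  have [n] := ubnP (d v); elim: n v => // n IHn v lt_n vC.
  apply: block_eq2; rewrite ?b_eq ?vC // => p /privateP[_ pC pv _ unv] dp.
  have tp z : z = p \/ sedge p z /\ z <> v -> g z = 0 :> nat.
    move=> zp; have zC : z \notin C.
      by case: zp => [-> //|[pz zv]]; apply/negP => /unv /(_ pz).
    apply: zero => // tC; apply: IHn => //.
    have -> : top z = top p; last by have := top_le p; lia.
    case: zp => [-> //|[pz zv]]; case: (edge_par pz) => [[_ lt]|[_ lt]].
      by rewrite (top_child pz).
    by apply: top_child; rewrite // sedge_sym.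
  apply/forallP=> z; apply/implyP=> /orP zp; apply/eqP/tp.
  by case: zp => [/eqP|/andP[pz /eqP]]; [left|right].
apply/ffunP=> z; apply: val_inj; rewrite /= two_onE.
by case: (boolP (z \in C)) => [/two //|zC]; apply: zero => // /two.
Qed.

End StrongCertificates.

(** * Existence of certificates *)

Section StrongEquality.

Variables (G : sgraph) (X : {set G}).
Implicit Types (g : {ffun G -> 'I_3}) (v y : G) (C : {set G}).

Definition update g v (a : 'I_3) : {ffun G -> 'I_3} :=
  [ffun x => if x == v then a else g x].

Lemma updateE g v a x : update g v a x = if x == v then a else g x.
Proof. by rewrite ffunE. Qed.

Lemma weight_update g v a : weight (update g v a) + g v = weight g + a.
Proof.
rewrite /weight (bigD1 v) //= [in RHS](bigD1 v) //= updateE eqxx.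
rewrite (eq_bigr (fun x => g x : nat)) => [|x /negPf xv]; last by rewrite updateE xv.
by rewrite -addnA addnC [X in X + a]addnC.
Qed.

(** The exceptional vertex [y] is defended by the unit of [v]: after the move [v] is dominated by
    [y], and every other vertex of [X] with value 0 still sees its value 2, which [v] never
    supplied. *)
Lemma wrdf_from_near_rdf g v y : sedge y v -> g v = 1 :> nat ->
  (forall x, x \in X -> x != y -> g x = 0 :> nat ->
     exists2 z, sedge x z & g z = 2 :> nat) ->
  wrdf X g.
Proof.
move=> yv gv near; apply/wrdfP=> u uX u0.
have y_v : y != v by apply: contraTneq yv => ->; rewrite sedge_irr.
have [eqy|uy] := eqVneq u y.
  subst u; apply/defendedP; exists v; split=> // [|x xX]; first by rewrite gv.
  rewrite /move; case: (eqVneq x y) => // xy.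
  case: (eqVneq x v) => [-> _|xv x0].
    by exists y; [rewrite eqxx | rewrite sedge_sym].
  have [z xz z2] := near x xX xy x0; exists z => //.
  by case: eqP => // _; case: eqP => [ezv|]; rewrite ?z2 // -ezv z2 in gv *.
have [z uz z2] := near u uX uy u0.
apply/defendedP; exists z; split=> // [|x xX]; first by rewrite z2.
have pos w : 0 < g w -> 0 < move g z u w.
  by rewrite /move; case: eqP => // _; case: eqP => // ->; rewrite z2.
move=> m0; have x0 : g x = 0 :> nat.
  by case: (posnP (g x)) => [//|/pos]; rewrite m0.
have [->|xy] := eqVneq x y; first by exists v => //; rewrite pos ?gv.
by have [w xw w2] := near x xX xy x0; exists w => //; rewrite pos ?w2.
Qed.

Lemma exists_min_wrdf : exists g, min_wrdf X g.
Proof.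
have W1 : wrdf X [ffun _ => inord 1].
  by apply/wrdfP=> u _; rewrite ffunE inordK.
case: (arg_minnP (@weight G) W1) => g W gmin.
by exists g; apply/min_wrdfP; split.
Qed.

Hypothesis strong : forall g, min_wrdf X g -> rdf X g.

Let i0 : 'I_3 := ord0.
Let i1 : 'I_3 := inord 1.

Let i1E : i1 = 1 :> nat. Proof. by rewrite inordK. Qed.

Lemma strong_even g v y : min_wrdf X g -> sedge v y -> g v <> 1 :> nat.
Proof.
move=> Mg vy gv; have /rdfP R := strong Mg; have /min_wrdfP[W gmin] := Mg.
have vy_neq : v != y by apply: contraTneq vy => ->; rewrite sedge_irr.
have v_bad : ~ (v \in X -> exists2 z, sedge v z & g z = 2 :> nat).
  move=> vX; have /wrdf_from_rdf/gmin : rdf X (update g v i0).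
    apply/rdfP=> x xX; rewrite updateE; case: eqP => [exv _|xv x0].
      rewrite exv in xX *; have [z vz z2] := vX xX; exists z; rewrite // updateE.
      by case: eqP => // ezv; rewrite ezv gv in z2.
    have [z xz z2] := R x xX x0; exists z; rewrite // updateE.
    by case: eqP => // ezv; rewrite ezv gv in z2.
  by have := weight_update g v i0; rewrite gv /=; lia.
have gy2 : g y <> 2 :> nat by move=> gy; apply: v_bad; exists y.
pose h := update (update g v i0) y i1.
have hE x : h x = if x == y then i1 else if x == v then i0 else g x.
  by rewrite !updateE.
have Wh : wrdf X h.
  apply: (wrdf_from_near_rdf vy) => [|x xX xv]; first by rewrite hE eqxx i1E.
  rewrite hE (negPf xv); case: eqP => [_|_ x0]; first by rewrite i1E.
  have [z xz z2] := R x xX x0; exists z; rewrite // hE.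
  case: eqP => [ezy|_]; first by rewrite -ezy in gy2.
  by case: eqP => // ezv; rewrite ezv gv in z2.
have wh : weight h + g y = weight g.
  have := weight_update (update g v i0) y i1; have := weight_update g v i0.
  by rewrite updateE eq_sym (negPf vy_neq) gv i1E /= -/h; lia.
have /rdfP Rh : rdf X h.
  by apply/strong/min_wrdfP; split=> // k /gmin; lia.
apply: v_bad => vX; have [|z vz] := Rh v vX; first by rewrite hE (negPf vy_neq) eqxx.
rewrite hE; case: eqP => _; first by rewrite i1E.
by case: eqP => // _ z2; exists z.
Qed.

(** All values are 0 or 2 by [strong_even]. If a vertex [v] of value 2 is lowered to 1, only its
    private neighbors lose their last 2. With at most one of them the function stays weak Roman,
    against minimality. With exactly two, raising [y1] to 1 restores the weight and gives a minimum
    function that is not Roman at [y2]. *)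
Lemma strong_certificate g : (forall v, exists y, sedge v y) -> min_wrdf X g ->
  certificate X [set v | g v == 2 :> nat].
Proof.
move=> nbr Mg; have /rdfP R := strong Mg; have /min_wrdfP[W gmin] := Mg.
set C := [set _ | _]; have CE v : (v \in C) = (g v == 2 :> nat) by rewrite inE.
have g0 v : v \notin C -> g v = 0 :> nat.
  have [y vy] := nbr v; have := strong_even Mg vy; have := ltn_ord (g v).
  by rewrite CE; case: (nat_of_ord (g v)) => [|[|[|]]].
split.
  apply/subsetP=> x xX; apply/closed_nbhP; have [|xC] := boolP (x \in C); first by left.
  have [z xz z2] := R x xX (g0 x xC); right; exists z; rewrite // CE; exact/eqP.
move=> v vC; rewrite ltnNge; apply/negP=> le2.
have gv : g v = 2 :> nat by apply/eqP; rewrite -CE.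
(* Lower [v] to 1, raising one of at most two private neighbors. *)
have other x : x \in X -> x \notin C -> x \notin private X C v ->
    exists2 z, sedge x z & z != v /\ g z = 2 :> nat.
  move=> xX xC xP; have [z xz z2] := R x xX (g0 x xC).
  have [ezv|] := eqVneq z v; last by exists z.
  have [/exists_inP[c cC /andP[xc cv]]|/exists_inPn nC] :=
      boolP [exists c in C, sedge x c && (c != v)].
    by exists c => //; split=> //; apply/eqP; rewrite -CE.
  case/negP: xP; apply/privateP; split; rewrite // -?ezv // ?ezv // => c cC xc.
  by have := nC c cC; rewrite xc negbK => /eqP.
pose h := update g v i1.
have hE x : h x = if x == v then i1 else g x by rewrite updateE.
have wh : weight h + 1 = weight g.
  by have := weight_update g v i1; rewrite gv i1E -/h; lia.
have low1 x : x \in X -> x \notin private X C v -> h x = 0 :> nat ->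
    exists2 z, sedge x z & h z = 2 :> nat.
  rewrite hE; case: eqP => [_ _ _|_ xX xP x0]; first by rewrite i1E.
  have [|z xz [zv z2]] := other x xX _ xP; first by rewrite CE x0.
  by exists z => //; rewrite hE (negPf zv).
have not_wh : ~ wrdf X h by move/gmin; lia.
case: (posnP #|private X C v|) => [/eqP|/card_gt0P[y1 P1]].
  rewrite cards_eq0 => /eqP P0; apply/not_wh/wrdf_from_rdf/rdfP=> x xX.
  by apply: low1; rewrite // P0 inE.
have only y : y \in private X C v -> sedge y v by case/privateP.
have hv : h v = 1 :> nat by rewrite hE eqxx i1E.
case: (leqP #|private X C v| 1) => [/card_le1_eqP uniqP|lt1].
  apply/not_wh/(wrdf_from_near_rdf (only _ P1) hv) => x xX xy1.
  by apply: low1 => //; apply: contra xy1 => Px; apply/eqP/uniqP.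
have [y2 P2 y12] : exists2 y2, y2 \in private X C v & y2 != y1.
  apply/exists_inP; apply: contraTT lt1 => /exists_inPn all1.
  rewrite -leqNgt -(cards1 y1); apply/subset_leq_card/subsetP=> y /all1.
  by rewrite inE negbK.
have P_le y : y \in private X C v -> (y == y1) || (y == y2).
  move=> Py; apply: contraTT le2; rewrite negb_or => /andP[yy1 yy2].
  have : [set y; y1; y2] \subset private X C v.
    by apply/subsetP=> z; rewrite !in_setU !in_set1 -orbA => /or3P[] /eqP->.
  by move/subset_leq_card; rewrite -setUA cardsU1 cards2 !inE negb_or yy1 yy2 eq_sym y12 -ltnNge.
have [y1C y2C] : y1 \notin C /\ y2 \notin C by case/privateP: P1; case/privateP: P2.
pose k := update h y1 i1.
have kE x : k x = if x == y1 then i1 else h x by rewrite updateE.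
have y1v : v != y1 by apply: contraNneq y1C => <-.
have y2v : y2 != v by apply: contraNneq y2C => ->.
have wk : weight k = weight g.
  by have := weight_update h y1 i1; rewrite -/k hE eq_sym (negPf y1v) g0 // i1E; lia.
have kv : k v = 1 :> nat by rewrite kE (negPf y1v).
have Wk : wrdf X k.
  apply: (wrdf_from_near_rdf (only _ P2) kv) => x xX xy2; rewrite kE.
  case: eqP => [|xy1 hx]; first by rewrite i1E.
  have [|z xz z2] := low1 x xX _ hx.
    by apply/negP=> /P_le; rewrite (negPf xy2) orbF; apply/negP/eqP.
  exists z => //; rewrite kE; case: eqP => // ezy.
  by rewrite ezy hE eq_sym (negPf y1v) g0 in z2.
have /rdfP Rk : rdf X k by apply/strong/min_wrdfP; split=> // f /gmin; lia.
case/privateP: (P2) => y2X _ _ _ unq; have [|z yz] := Rk y2 y2X.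
  by rewrite kE (negPf y12) hE (negPf y2v) g0.
rewrite kE hE; case: eqP => _; first by rewrite i1E.
case: eqP => [_|zv /eqP z2]; first by rewrite i1E.
by apply/zv/unq; rewrite ?CE.
Qed.

End StrongEquality.

(** * Certificates characterize [calS] *)

Section Characterization.

Variables (G : sgraph) (X : {set G}).
Implicit Types (g : {ffun G -> 'I_3}) (C : {set G}).

(** The set that [calS] prescribes for [tY]. *)
Definition covered : {set G} :=
  [set u | [exists g, min_wrdf X g &&
             [|| 1 <= g u | (g u == 0 :> nat) && defended X g u]]].

Lemma tree_layered : is_tree G -> exists d : G -> nat, layered d.
Proof.
move=> tG; have [/card_gt0P[r _] _ _] := tG.
by have [d [lay _]] := tree_rooted r tG; exists d.
Qed.

Lemma certificate_min C g : is_tree G -> certificate X C ->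
  min_wrdf X g <-> g = two_on C.
Proof.
move=> /tree_layered[d lay] cert; have W := wrdf_from_rdf (two_on_rdf cert.1).
split=> [/min_wrdfP[Wg /(_ _ W)]|->]; first exact: certificate_unique lay _ Wg cert.
by apply/min_wrdfP; split=> // h Wh; apply: certificate_bound lay _ Wh cert.
Qed.

Lemma certificate_strong C g : is_tree G -> certificate X C ->
  min_wrdf X g -> rdf X g.
Proof. by move=> tG cert /(certificate_min _ tG cert) ->; apply: two_on_rdf cert.1. Qed.

Lemma certificate_covered C : is_tree G -> certificate X C ->
  covered = closed_nbh C.
Proof.
move=> tG cert; have min := certificate_min _ tG cert.
have c2 u : [|| 1 <= two_on C u | (two_on C u == 0 :> nat) && defended X (two_on C) u]
            = (u \in closed_nbh C).
  rewrite inE two_onE; case: (boolP (u \in C)) => //= uC.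
  by rewrite defended_two_on ?cert.1.
apply/setP=> u; rewrite inE -c2; apply/existsP/idP => [[g /andP[/min -> //]]|cu].
by exists (two_on C); rewrite cu andbT; apply/min.
Qed.

Lemma tree_neighbor (v : G) : is_tree G -> #|G| <> 1 -> exists y : G, sedge v y.
Proof.
move=> [_ conn _] G1; have [y yv] : exists y, y != v.
  apply/existsP; apply: contraT => /existsPn all_v; case: G1.
  by rewrite -(card1 v); apply: eq_card => y; rewrite !inE; have := all_v y; rewrite negbK.
have /connectP[[|z p] /=] := conn v y; first by move=> _ eyv; rewrite eyv eqxx in yv.
by case/andP=> vz _ _; exists z.
Qed.

Lemma point_no_edge (x y : G) : #|G| = 1 -> sedge x y = false.
Proof.
by move=> G1; rewrite (fintype_le1P _ x y) ?G1 // sedge_irr.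
Qed.

Lemma point_set (A : {set G}) : #|G| = 1 -> A = set0 \/ A = setT.
Proof.
move=> G1; have [->|[x xA]] := set_0Vmem A; first by left.
by right; apply/setP=> y; rewrite inE (fintype_le1P _ x y) ?G1.
Qed.

Lemma point_defended g u : #|G| = 1 -> defended X g u = false.
Proof. by move=> G1; apply/existsP=> -[v]; rewrite point_no_edge. Qed.

(** A single vertex with [X = setT] stands apart: its minimum function has value 1, and it admits no
    certificate. *)
Lemma strong_cases : is_tree G -> (forall g, min_wrdf X g -> rdf X g) ->
  #|G| = 1 /\ X = setT \/ exists C, certificate X C.
Proof.
move=> tG strong; have [G1|G1] := eqVneq #|G| 1.
  case: (point_set X G1) => ->; [right|by left].
  by exists set0; split=> [|v]; rewrite ?sub0set ?inE.
right; have [g Mg] := exists_min_wrdf X.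
exists [set v | g v == 2 :> nat]; apply: strong_certificate => // v.
by apply: tree_neighbor => //; apply/eqP.
Qed.

Lemma point_positive g u : #|G| = 1 -> X = setT -> wrdf X g -> g u <> 0 :> nat.
Proof.
move=> G1 XT /wrdfP W u0; have := W u.
by rewrite point_defended // XT inE => /(_ isT u0).
Qed.

Lemma point_covered : #|G| = 1 -> X = setT -> covered = setT.
Proof.
move=> G1 XT; apply/setP=> u; rewrite !inE; have [g Mg] := exists_min_wrdf X.
apply/existsP; exists g; rewrite Mg lt0n; apply/orP; left; apply/eqP.
by apply: point_positive => //; case/min_wrdfP: Mg.
Qed.

End Characterization.

Definition certified (t : triple) : Prop :=
  is_tree (tgraph t) /\
  ([/\ #|tgraph t| = 1, tX t = setT & tY t = setT] \/
   exists2 C, certificate (tX t) C & tY t = closed_nbh C).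

Lemma calS_certified t : calS t <-> certified t.
Proof.
case: t => G X Y; rewrite /calS /certified /= -/(covered X); split.
  case=> tG strong eqY; split=> //; case: (strong_cases tG strong) => [[G1 XT]|[C cert]].
    by left; split; rewrite // eqY point_covered.
  by right; exists C; rewrite // eqY; apply: certificate_covered.
case=> tG [[G1 XT YT]|[C cert ->]]; split=> //.
- move=> g /min_wrdfP[Wg _]; apply/rdfP=> u _ u0.
  by case: (@point_positive _ X g u).
- by rewrite point_covered.
- by move=> g; apply: certificate_strong tG cert.
- by rewrite (certificate_covered tG cert).
Qed.

(** * The operations preserve certificates *)

Lemma add_leaf_tree (G : sgraph) (u : G) : is_tree G -> is_tree (add_leaf u).
Proof.
move=> tG; have [/card_gt0P[r _] _ _] := tG.
have [d [[dE dU] low]] := tree_rooted r tG.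
apply: (@rooted_tree (add_leaf u) (Some r) (fun a => if a is Some x then d x else (d u).+1)).
split; first split.
- by move=> [x|] [y|] //=; [apply: dE | move/eqP->; lia | move/eqP->; lia].
- move=> [x|] [y|] [z|] //=; try by move=> *; lia.
  + by move=> xy xz ly lz; rewrite (dU x y z).
  + by move=> _ /eqP->; lia.
  + by move=> /eqP->; lia.
  + by move=> /eqP-> /eqP->.
move=> [x|] /= x_r; last by exists (Some u) => /=; rewrite ?eqxx.
have [|y xy ly] := low x; last by exists (Some y).
by apply: contraNneq x_r => ->.
Qed.

Lemma add_star_tree (G : sgraph) (u : G) n : is_tree G -> is_tree (add_star u n).
Proof.
move=> tG; have [/card_gt0P[r _] _ _] := tG.
have [d [[dE dU] low]] := tree_rooted r tG.
apply: (@rooted_tree (add_star u n) (inl r)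
  (fun a => match a with inl x => d x | inr None => d u + 1 | inr _ => d u + 2 end)).
split; first split.
- by move=> [x|[i|]] [y|[j|]] //=; try by [apply: dE | move/eqP->; lia | lia].
- move=> [x|[i|]] [y|[j|]] [z|[k|]] //=; try by move=> *; lia.
  + by move=> xy xz ly lz; rewrite (dU x y z).
  + by move=> _ /eqP->; lia.
  + by move=> /eqP->; lia.
  + by move=> /eqP-> /eqP->.
move=> [x|[i|]] /= x_r.
- have [|y xy ly] := low x; last by exists (inl y).
  by apply: contraNneq x_r => ->.
- by exists (inr None); lia.
by exists (inl u) => /=; rewrite ?eqxx //; lia.
Qed.

Section NewVertices.

Variables (G : sgraph) (u : G) (n : nat).
Implicit Types (A : {set G}) (x : G).

Lemma old_leaf_inj : injective (old_leaf u).
Proof. by move=> x y []. Qed.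

Lemma old_leaf_None A : None \in old_leaf u @: A = false.
Proof. by apply/imsetP=> -[]. Qed.

Lemma old_leaf_Some A x : Some x \in old_leaf u @: A = (x \in A).
Proof. exact: (mem_imset _ _ old_leaf_inj). Qed.

Lemma old_star_inj : injective (old_star u n).
Proof. by move=> x y []. Qed.

Lemma old_star_inl A x : inl x \in old_star u n @: A = (x \in A).
Proof. exact: (mem_imset _ _ old_star_inj). Qed.

Lemma old_star_inr A i : inr i \in old_star u n @: A = false.
Proof. by apply/imsetP=> -[]. Qed.

Lemma rays_inl x : inl x \in rays u n = false.
Proof. by apply/imsetP=> -[]. Qed.

Lemma rays_center : inr None \in rays u n = false.
Proof. by apply/imsetP=> -[]. Qed.

Lemma rays_Some i : inr (Some i) \in rays u n.
Proof. exact: imset_f. Qed.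

End NewVertices.

Section Embeddings.

Variables (H G : sgraph) (f : H -> G) (X C : {set H}) (X' C' : {set G}).
Hypothesis f_edge : forall x y, sedge (f x) (f y) = sedge x y.
Hypothesis f_C : forall x, (f x \in C') = (x \in C).

Lemma closed_nbh_embed x : x \in closed_nbh C -> f x \in closed_nbh C'.
Proof.
case/closed_nbhP=> [xC|[c cC xc]]; apply/closed_nbhP; rewrite f_C; first by left.
by right; exists (f c); rewrite ?f_C ?f_edge.
Qed.

(** Privacy survives an embedding as long as [f y] gains no neighbor in [C'] outside the image. *)
Lemma private_embed v y : y \in private X C v -> f y \in X' ->
  (forall c, c \in C' -> sedge (f y) c -> exists a, c = f a) ->
  f y \in private X' C' (f v).
Proof.
case/privateP=> yX yC yv vC unv fyX old; apply/privateP.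
split; rewrite ?f_C ?f_edge // => c cC yc; have [a ea] := old c cC yc.
by rewrite ea; congr f; move: cC yc; rewrite ea f_C f_edge; apply: unv.
Qed.

End Embeddings.

Lemma private_closed_nbh (G : sgraph) (X C : {set G}) v y :
  y \in private X C v -> y \in closed_nbh C.
Proof. by case/privateP=> _ _ yv vC _; apply/closed_nbhP; right; exists v. Qed.

Section AddLeafCertificate.

Variables (G : sgraph) (u : G) (X C : {set G}).

(** The case [u \in C] gives the set [Y] of Operation 4, the other case that of Operations 1 and
    5. *)
Lemma add_leaf_closed_nbh : closed_nbh (old_leaf u @: C) =
  if u \in C then new_leaf u |: old_leaf u @: closed_nbh C
  else old_leaf u @: closed_nbh C.
Proof.
have NbS x : (Some x \in closed_nbh (old_leaf u @: C)) = (x \in closed_nbh C).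
  apply/closed_nbhP/closed_nbhP; rewrite old_leaf_Some => -[]; try by left.
    by move=> [_ /imsetP[c cC ->]] xc; right; exists c.
  by move=> [c cC xc]; right; exists (Some c); rewrite // old_leaf_Some.
have NbN : (None \in closed_nbh (old_leaf u @: C)) = (u \in C).
  apply/closed_nbhP/idP; rewrite old_leaf_None; last first.
    by move=> uC; right; exists (Some u); rewrite ?old_leaf_Some //= eqxx.
  by case=> // -[_ /imsetP[c cC ->] /eqP <-].
apply/setP=> -[x|]; rewrite ?NbS ?NbN; case: ifP => _;
  by rewrite ?in_setU1 ?old_leaf_Some ?old_leaf_None.
Qed.

Lemma add_leaf_certificate (X' : {set add_leaf u}) : certificate X C ->
  X' = old_leaf u @: X \/ u \in C /\ X' = new_leaf u |: old_leaf u @: X ->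
  certificate X' (old_leaf u @: C).
Proof.
move=> [XC priv] X'E; have XX' : old_leaf u @: X \subset X'.
  by case: X'E => [|[_]] ->; rewrite ?subsetU1.
split.
  have sub : old_leaf u @: X \subset closed_nbh (old_leaf u @: C).
    rewrite add_leaf_closed_nbh; apply: subset_trans (imsetS _ XC) _.
    by case: ifP => _; rewrite ?subsetU1.
  case: X'E => [->//|[uC ->]]; rewrite subUset sub andbT sub1set.
  by rewrite add_leaf_closed_nbh uC setU11.
move=> _ /imsetP[v vC ->]; apply: leq_trans (priv v vC) _.
rewrite -(card_imset _ (@old_leaf_inj _ u)); apply/subset_leq_card/subsetP=> _ /imsetP[y yP ->].
apply: (private_embed _ _ yP) => //; first by move=> x; rewrite old_leaf_Some.
  by apply: (subsetP XX'); apply: imset_f; case/privateP: yP.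
by move=> _ /imsetP[c _ ->] _; exists c.
Qed.

End AddLeafCertificate.

Section AddStarCertificate.

Variables (G : sgraph) (u : G) (n : nat) (X C : {set G}).

Let Cs : {set add_star u n} := center u n |: old_star u n @: C.

Let CsE a : (a \in Cs) = match a with inl x => x \in C | inr None => true | _ => false end.
Proof.
by case: a => [x|[i|]]; rewrite in_setU1 ?old_star_inl ?old_star_inr ?orbF.
Qed.

Lemma add_star_closed_nbh : closed_nbh Cs =
  old_star u n @: (u |: closed_nbh C) :|: (center u n |: rays u n).
Proof.
apply/setP=> -[x|[i|]]; rewrite in_setU in_setU1 ?old_star_inl ?old_star_inr ?rays_inl
  ?rays_Some ?orbT ?eqxx.
- rewrite !orbF in_setU1; apply/closed_nbhP/orP.
    rewrite CsE => -[xC|[[y|[j|]]]]; rewrite ?CsE //=.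
    + by right; apply/closed_nbhP; left.
    + by move=> yC xy; right; apply/closed_nbhP; right; exists y.
    by left.
  case=> [xu|]; first by right; exists (inr None); rewrite ?CsE.
  case/closed_nbhP=> [xC|[c cC xc]]; first by left; rewrite CsE.
  by right; exists (inl c); rewrite ?CsE.
- by apply/closed_nbhP; right; exists (inr None); rewrite ?CsE.
by apply/closed_nbhP; left; rewrite CsE.
Qed.

(** The center joins the certificate. As it becomes a neighbor of [u], no old vertex may count on
    [u] as private; Operation 2 ensures this by [u \notin Y], Operation 3 by [u \notin X]. The
    private neighbors of the center are the rays and, when there are only two, also [u]. The two
    inclusions for [X'] cover all admissible choices at once. *)
Lemma add_star_certificate (X' : {set add_star u n}) : certificate X C ->
  (forall v, u \notin private X C v) ->
  old_star u n @: X :|: rays u n \subset X' ->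
  X' \subset old_star u n @: (u |: X) :|: (center u n |: rays u n) ->
  2 < n \/ [/\ 1 < n, old_star u n u \in X' & u \notin closed_nbh C] ->
  certificate X' Cs.
Proof.
move=> [XC priv] nu; rewrite subUset => /andP[XX' rX'] X'S n3; split.
  rewrite add_star_closed_nbh; apply: subset_trans X'S _.
  by rewrite setSU // imsetS // setUS.
have ray_private i : inr (Some i) \in private X' Cs (center u n).
  apply/privateP; split; rewrite ?CsE //; first by apply/(subsetP rX')/rays_Some.
  by move=> [x|[j|]]; rewrite ?CsE.
have rays_sub : rays u n \subset private X' Cs (center u n).
  by apply/subsetP=> _ /imsetP[i _ ->].
have rays_card : #|rays u n| = n.
  by rewrite card_imset ?card_ord // => i j [].
move=> v; rewrite in_setU1 => /orP[/eqP->|/imsetP[c cC ->]].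
  case: n3 => [n3|[n2 uX uC]].
    by apply: leq_trans (subset_leq_card rays_sub); rewrite rays_card.
  apply: leq_trans (subset_leq_card (_ : old_star u n u |: rays u n \subset _)).
    by rewrite cardsU1 rays_inl rays_card.
  rewrite subUset rays_sub sub1set andbT; apply/privateP; split; rewrite ?CsE //=.
    by apply: contra uC => uC; apply/closed_nbhP; left.
  move=> [x|[j|]]; rewrite ?CsE //= => xC ux; case/closed_nbhP: uC; right.
  by exists x.
apply: leq_trans (priv c cC) _.
rewrite -(card_imset _ (@old_star_inj _ u n)); apply/subset_leq_card/subsetP=> _ /imsetP[y yP ->].
apply: (private_embed _ _ yP) => //.
- by apply: (subsetP XX'); apply: imset_f; case/privateP: yP.
move=> [x|[j|]]; rewrite ?CsE //=; first by exists x.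
by move=> _ /eqP eyu; have := nu c; rewrite -eyu yP.
Qed.

End AddStarCertificate.

(** * Position of a configuration relative to a certificate *)

Section Configurations.

Variables (G : sgraph) (X C : {set G}) (v u : G) (k : nat) (w : 'I_k -> G).
Hypothesis cert : certificate X C.
Hypothesis conf : config X (closed_nbh C) v u w.

Lemma comp_del_nbr i x : sedge (w i) x -> x != v -> w i != v -> x \in comp_del v (w i).
Proof. by move=> wx xv wv; rewrite inE; apply: connect1; rewrite wv xv. Qed.

Lemma config_edge i : sedge v (w i).
Proof. by case: conf => _ _ /setP/(_ (w i)) + _; rewrite !inE imset_f ?orbT. Qed.

Lemma config_neq i : w i != v.
Proof. by apply: contraTneq (config_edge i) => ->; rewrite sedge_irr. Qed.

(** Apart from [v], the neighbors of [w i] lie in its component, which meets [X] in at most [w i].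
    So [w i] has at most one private neighbor. *)
Lemma config_ray i : w i \notin C.
Proof.
apply/negP=> wC; have : private X C (w i) \subset [set v].
  apply/subsetP=> y /privateP[yX yC yw _ _]; rewrite inE; apply: contraT => yv.
  have wy : y \in comp_del v (w i) by rewrite comp_del_nbr ?config_neq // sedge_sym.
  have compX : comp_del v (w i) :&: X \subset [set w i].
    case: conf => _ _ _ [l [_ lo hi _]].
    by case: (ltnP i l) => [/lo->|/hi->]; rewrite ?sub0set.
  have := subsetP compX y; rewrite in_setI wy yX in_set1 => /(_ isT)/eqP eyw.
  by rewrite eyw sedge_irr in yw.
by move/subset_leq_card; rewrite cards1; have := cert.2 _ wC; lia.
Qed.

(** A vertex [w i] lies in the closed neighborhood of [C] but not in [C], so it has a neighbor in
    [C]. Its component meets that closed neighborhood only in [w i], which leaves [v] as this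
    neighbor. *)
Lemma config_center : v \in C.
Proof.
have [_ _ _ [l [/andP[l1 lk] _ _ Y1]]] := conf.
have k0 : 0 < k by lia.
have compY : comp_del v (w (Ordinal k0)) :&: closed_nbh C = [set w (Ordinal k0)].
  by case: Y1 => -[].
set i := Ordinal k0 in compY.
have : w i \in closed_nbh C by have := set11 (w i); rewrite -compY in_setI => /andP[].
case/closed_nbhP=> [|[c cC wc]]; first by rewrite (negPf (config_ray i)).
have [<- //|cv] := eqVneq c v.
have : c \in [set w i].
  rewrite -compY in_setI comp_del_nbr ?config_neq //=.
  by apply/closed_nbhP; left.
by rewrite inE => /eqP ecw; rewrite ecw sedge_irr in wc.
Qed.

End Configurations.

Lemma rooted_pullback (G H : sgraph) (f : H -> G) (d : G -> nat) (r : H) :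
  bijective f -> (forall x y, sedge (f x) (f y) = sedge x y) ->
  rooted (f r) d -> rooted r (d \o f).
Proof.
move=> bij_f f_edge [[dE dU] low]; have inj_f := bij_inj bij_f.
split; first split=> [x y xy|x y z xy xz ly lz].
- by apply: dE; rewrite f_edge.
- by apply: inj_f; apply: (dU (f x)); rewrite ?f_edge.
move=> x xr; have [|y fxy ly] := low (f x); first by rewrite inj_eq.
case: bij_f => g fK gK; exists (g y); last by rewrite /= gK.
by rewrite -f_edge gK.
Qed.

Lemma certified_iso t t' : triple_iso t t' -> certified t -> certified t'.
Proof.
case: t t' => G X Y [G' X' Y'] [f /= [bij_f f_edge <- <-]] [/= tG cert].
have inj_f := bij_inj bij_f; have [h fK hK] := bij_f.
have h_edge x y : sedge (h x) (h y) = sedge x y by rewrite -f_edge !hK.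
have bij_h : bijective h by exists f.
split=> /=.
  have [/card_gt0P[r _] _ _] := tG; have [d rd] := tree_rooted r tG.
  apply: (@rooted_tree _ (f r) (d \o h)); apply: rooted_pullback => //.
  by rewrite fK.
have fT : f @: [set: G] = setT.
  by apply/setP=> y; rewrite inE -[y]hK imset_f.
case: cert => [[G1 -> ->]|[C [XC priv] ->]]; [left|right].
  by split=> //; rewrite -G1; apply/esym/bij_eq_card; exists h.
have fC (A : {set G}) x : (f x \in f @: A) = (x \in A) by rewrite mem_imset.
have fcn : f @: closed_nbh C = closed_nbh (f @: C).
  apply/setP=> y; rewrite -[y]hK fC; apply/idP/idP.
    exact: closed_nbh_embed f_edge (fC C) _.
  move=> yC; rewrite -[h y]fK; apply: (closed_nbh_embed _ _ yC) => // x.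
  by rewrite -{2}[x]hK fC.
exists (f @: C) => //; split; first by rewrite -fcn imsetS.
move=> _ /imsetP[v vC ->]; apply: leq_trans (priv v vC) _.
rewrite -(card_imset _ inj_f); apply/subset_leq_card/subsetP=> _ /imsetP[y yP ->].
apply: (private_embed f_edge (fC C) yP); first by rewrite fC; case/privateP: yP.
by move=> c _ _; exists (h c).
Qed.

Lemma operation_certified (G : sgraph) (X Y : {set G}) t' :
  certified (Triple X Y) -> operation X Y t' -> certified t'.
Proof.
move=> [/= tG cert] op; split.
  by case: op => *; [apply: add_leaf_tree | apply: add_star_tree | apply: add_star_tree
    | apply: add_leaf_tree | apply: add_leaf_tree].
case: cert => [[G1 XT YT]|[C cert eqY]]; [exfalso|right].
  (* On a single vertex with [X = Y = setT] no operation applies; a configuration would need the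
     distinct vertices [u] and [w i]. *)
  have no_config v u k (w : 'I_k -> G) : ~ config X Y v u w.
    move=> [_ wu _ [l [/andP[l1 lk] _ _ _]]]; have k0 : 0 < k by lia.
    by have := wu (Ordinal k0); rewrite (fintype_le1P _ u (w _)) ?G1 ?eqxx.
  case: op => [u|u X'|u X'|v u k w X' /no_config|v u k w i /no_config] //.
  - by rewrite YT inE.
  - by rewrite YT inE.
  by rewrite XT inE.
case: op => [u|u X' + X'E|u X' uX X'E|v u k w X'|v u k w i]; rewrite eqY.
- move=> uY; have uC : u \notin C by apply: contra uY => uC; apply/closed_nbhP; left.
  exists (old_leaf u @: C); last by rewrite add_leaf_closed_nbh (negPf uC).
  exact: (add_leaf_certificate cert (or_introl erefl)).
- move=> uY; exists (center u 2 |: old_star u 2 @: C); last by rewrite add_star_closed_nbh.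
  have uX' : old_star u 2 u \in X' by case: X'E => ->; rewrite in_setU imset_f ?setU11.
  apply: (add_star_certificate cert).
  + by move=> v; apply: contra uY; apply: private_closed_nbh.
  + by case: X'E => ->; rewrite setUSS ?imsetS ?subsetU1 ?subsetUr.
  + by case: X'E => ->; rewrite setUSS ?subsetU1.
  + by right; split.
- exists (center u 3 |: old_star u 3 @: C); last by rewrite add_star_closed_nbh.
  apply: (add_star_certificate cert).
  + by move=> v; apply: contra uX; case/privateP.
  + by case: X'E => ->; rewrite setUSS ?imsetS ?subsetU1 ?subsetUr.
  + by case: X'E => ->; rewrite setUSS ?imsetS ?subsetU1.
  + by left.
- move=> conf X'E; have vC := config_center cert conf.
  exists (old_leaf v @: C); last by rewrite add_leaf_closed_nbh vC.
  by apply: (add_leaf_certificate cert); case: X'E; [left|right].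
move=> conf; have wC := config_ray cert conf i.
exists (old_leaf (w i) @: C); last by rewrite add_leaf_closed_nbh (negPf wC).
exact: (add_leaf_certificate cert (or_introl erefl)).
Qed.

Lemma calT_certified t : calT t -> certified t.
Proof.
have tree1 : is_tree K1.
  by apply: (@rooted_tree K1 tt (fun _ => 0)); split=> [|[]].
elim=> {t} [||G X Y t' _ IH _ _|t t' iso _]; last exact: certified_iso.
- split=> //; right; exists set0; last first.
    by apply/setP=> x; rewrite !inE; apply/esym/exists_inP=> -[c]; rewrite inE.
  by split=> [|v]; rewrite ?sub0set ?inE.
- by split=> //; left; rewrite card_unit.
exact: operation_certified.
Qed.

(** * Undoing an operation *)

Lemma mem_preimset (T U : finType) (f : T -> U) (B : {set U}) x :
  (x \in f @^-1: B) = (f x \in B).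
Proof. by rewrite inE. Qed.

Section InducedSubgraphs.

Variables (G : sgraph) (A : {set G}).

Definition induced_rel : rel {x | x \in A} := fun x y => sedge (val x) (val y).

Lemma induced_sym : symmetric induced_rel.
Proof. by move=> x y; apply: sedge_sym. Qed.

Lemma induced_irr : irreflexive induced_rel.
Proof. by move=> x; apply: sedge_irr. Qed.

Definition induced : sgraph := SGraph induced_sym induced_irr.

Definition embed (x : induced) : G := val x.

Lemma embed_in x : embed x \in A.
Proof. exact: valP. Qed.

Lemma embed_inj : injective embed.
Proof. exact: val_inj. Qed.

Lemma embedP x : x \in A -> exists x' : induced, embed x' = x.
Proof. by move=> xA; exists (exist _ x xA). Qed.

Lemma card_induced : #|induced| = #|A|.
Proof. exact: card_sig. Qed.

(** Since [A] contains the parents of its vertices, each vertex other than the root keeps a lower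
    neighbor, and the induced subgraph is again a rooted tree. *)
Lemma induced_rooted r d : rooted (embed r) d ->
  (forall x y, x \in A -> sedge x y -> d y < d x -> y \in A) ->
  rooted r (d \o embed).
Proof.
move=> [[dE dU] low] down; split; first split=> [x y|x y z xy xz ly lz]; first exact: dE.
  by apply: embed_inj; apply: (dU (embed x)).
move=> x xr; have [|y xy ly] := low (embed x); first by rewrite (inj_eq embed_inj).
by have [y' ey] := embedP (down _ _ (embed_in x) xy ly); subst y; exists y'.
Qed.

Lemma induced_closed_nbh (C : {set G}) : C \subset A ->
  closed_nbh (embed @^-1: C) = embed @^-1: closed_nbh C.
Proof.
move=> CA; apply/setP=> x; rewrite [RHS]inE; apply/closed_nbhP/closed_nbhP; rewrite inE.
  by case=> [|[c]]; [left | rewrite inE; right; exists (embed c)].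
case=> [|[c cC xc]]; first by left.
by have [c' ec] := embedP (subsetP CA c cC); subst c; right; exists c'; rewrite ?inE.
Qed.

Lemma induced_certificate (X C : {set G}) : C \subset A ->
  X :&: A \subset closed_nbh C ->
  (forall v, v \in C -> 2 < #|private X C v :&: A|) ->
  certificate (embed @^-1: X) (embed @^-1: C).
Proof.
move=> CA XC priv; split.
  rewrite induced_closed_nbh //; apply/subsetP=> x; rewrite !mem_preimset => xX.
  by apply: (subsetP XC); rewrite in_setI xX embed_in.
move=> v; rewrite mem_preimset => vC; apply: leq_trans (priv _ vC) _.
apply: leq_trans (leq_imset_card embed _); apply/subset_leq_card/subsetP=> y.
case/setIP=> /privateP[yX yC yv _ unv] yA; have [y' ey] := embedP yA; subst y.
apply: imset_f; apply/privateP; rewrite !mem_preimset; split=> // c.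
by rewrite mem_preimset => cC yc; apply: embed_inj; apply: unv.
Qed.

End InducedSubgraphs.

(** * The configuration at a deepest vertex of [C] *)

Section DeepestCenter.

Variables (G : sgraph) (r : G) (d : G -> nat).
Hypothesis root : rooted r d.

Let dE := root.1.1.
Let dU := root.1.2.

Definition descendants (w : G) : {set G} :=
  [set y | connect (fun a b => sedge a b && (d a < d b)) w y].

Lemma descendants_self w : w \in descendants w.
Proof. by rewrite inE connect0. Qed.

Lemma descendants_up w a b : a \in descendants w -> sedge a b -> d a < d b ->
  b \in descendants w.
Proof.
by rewrite !inE => wa ab lt; apply: connect_trans wa (connect1 _); rewrite ab.
Qed.

Lemma descendantsP w y : y \in descendants w ->
  y = w \/ exists2 z, z \in descendants w & sedge z y && (d z < d y).
Proof.
rewrite inE => /connectP[p]; case/lastP: p => [|p b]; first by left.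
rewrite rcons_path last_rcons => /andP[wp wb] ->; right.
by exists (last w p); rewrite // inE; apply/connectP; exists p.
Qed.

Lemma descendants_le w y : y \in descendants w -> d w <= d y.
Proof.
have [n] := ubnP (d y); elim: n y => // n IHn y lt_n /descendantsP[-> //|[z wz /andP[_ zy]]].
by have := IHn z _ wz; lia.
Qed.

Lemma descendants_down w y b : y \in descendants w -> y != w -> sedge y b ->
  d b < d y -> b \in descendants w.
Proof.
move=> /descendantsP[->|[z wz /andP[zy ltz]]]; rewrite ?eqxx // => _ yb ltb.
by rewrite (dU yb _ ltb ltz) // sedge_sym.
Qed.

(** An edge leaving the subtree below [w] can only go up from [w] itself, hence to its parent
    [v]. *)
Lemma comp_del_descendants v w : sedge v w -> d v < d w ->
  comp_del v w = descendants w.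
Proof.
move=> vw ltvw; apply/eqP; rewrite eqEsubset; apply/andP; split; apply/subsetP=> y.
  rewrite inE => /connectP[p]; elim/last_ind: p y => [|p b IHp] y /=.
    by move=> _ ->; apply: descendants_self.
  rewrite rcons_path last_rcons => /andP[wp /and3P[av bv ab]] ->.
  have {IHp wp} := IHp _ wp erefl; move: (last w p) av ab => a av ab wa.
  case: (ltngtP (d a) (d b)) (dE ab) => // lt _; first exact: descendants_up wa ab lt.
  have [eaw|aw] := eqVneq a w; last exact: descendants_down wa aw ab lt.
  subst a; have wv : sedge w v by rewrite sedge_sym.
  by rewrite (dU ab wv lt ltvw) eqxx in bv.
have [n] := ubnP (d y); elim: n y => // n IHn y lt_n wy.
have neq_v z : z \in descendants w -> z != v.
  by move/descendants_le => le; apply: contraTneq ltvw => <-; rewrite -leqNgt.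
case/descendantsP: (wy) => [->|[z wz /andP[zy ltz]]]; first by rewrite inE connect0.
have := IHn z _ wz; rewrite !inE => conn; apply: connect_trans (conn _) (connect1 _); first lia.
by rewrite !neq_v.
Qed.

Variables (X C : {set G}) (v : G).
Hypotheses (cert : certificate X C) (vC : v \in C).
Hypothesis deepest : forall c, c \in C -> d c <= d v.

(** The subtree below [w] lies deeper than all of [C], and it is joined to the rest of the tree by
    the edge [vw] alone. *)
Lemma descendants_closed_nbh w : sedge v w -> d v < d w ->
  descendants w :&: closed_nbh C = [set w].
Proof.
move=> vw lt; have noC y : y \in descendants w -> y \notin C.
  by move/descendants_le => le; apply/negP=> /deepest; lia.
apply/setP=> y; rewrite in_setI in_set1; apply/andP/eqP => [[wy]|->]; last first.
  split; first exact: descendants_self.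
  by apply/closed_nbhP; right; exists v; rewrite // sedge_sym.
case/closed_nbhP=> [|[c cC yc]]; first by rewrite (negPf (noC y wy)).
apply/eqP; apply: contraT => yw; have wc : c \in descendants w.
  have [ltc|lec] := ltnP (d c) (d y); first exact: descendants_down wy yw yc ltc.
  by have := deepest cC; have := descendants_le wy; lia.
by have := noC c wc; rewrite cC.
Qed.

(** Here [u] is the parent of [v] and [w] lists all its children. The private neighbors of [v] are
    children in [X] and possibly [u], so at least two children are in [X], and if exactly two then
    [u] is private and thus in [X]. *)
Lemma config_deepest : v != r -> exists u k (w : 'I_k -> G),
  config X (closed_nbh C) v u w /\
  forall y, sedge v y -> d v < d y -> exists i, w i = y.
Proof.
move=> /root.2[u vu ltu]; pose K := nbh v :\ u.
have Kup y : y \in K = (sedge v y && (d v < d y)).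
  rewrite !inE andbC; case vy: (sedge v y) => //=.
  case: (ltngtP (d v) (d y)) (dE vy) => // lt _.
    by apply: contraTneq ltu => <-; rewrite -leqNgt ltnW.
  by rewrite (dU vy vu lt ltu) eqxx.
(* Children in [X] come first, as the threshold [l] in [config] demands. *)
pose s := enum (K :&: X) ++ enum (K :\: X).
have sK y : (y \in s) = (y \in K).
  by rewrite mem_cat !mem_enum !inE; case: (y \in X); rewrite ?andbT ?andbF ?orbF.
have uniq_s : uniq s.
  rewrite cat_uniq !enum_uniq andbT; apply/hasPn=> y.
  by rewrite !mem_enum !inE => /andP[/negPf->]; rewrite andbF.
pose k := size s; pose w (i : 'I_k) := nth v s i.
have wK i : w i \in K by rewrite -sK mem_nth.
have Kw y : y \in K -> exists i, w i = y.
  rewrite -sK => ys; have lt : index y s < k by rewrite index_mem.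
  by exists (Ordinal lt); rewrite /w nth_index.
exists u, k, w; split; last by move=> y vy lty; apply: Kw; rewrite Kup vy.
have [uY vY] : u \in closed_nbh C /\ v \in closed_nbh C.
  by split; apply/closed_nbhP; [right; exists v; rewrite // sedge_sym | left].
pose l := #|K :&: X|.
have szk : k = l + #|K :\: X| by rewrite /k size_cat -!cardE.
have lo (i : 'I_k) : i < l -> w i \in X.
  move=> il; have : w i \in enum (K :&: X).
    by rewrite /w nth_cat -cardE il mem_nth // -cardE.
  by rewrite mem_enum inE => /andP[].
have hi (i : 'I_k) : l <= i -> w i \notin X.
  move=> il; have : w i \in enum (K :\: X).
    rewrite /w nth_cat -cardE ltnNge il /= mem_nth //.
    have ltk : i < l + #|K :\: X| by rewrite -szk.
    by rewrite -cardE -/l ltn_subLR.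
  by rewrite mem_enum inE => /andP[].
have compY i : comp_del v (w i) :&: closed_nbh C = [set w i].
  have := wK i; rewrite Kup => /andP[vw lt].
  by rewrite comp_del_descendants // descendants_closed_nbh.
have compX i : comp_del v (w i) :&: X = [set w i] :&: X.
  by rewrite -(compY i) -setIA (setIidPr cert.1).
have Pl : #|private X C v| <= (u \in private X C v) + l.
  rewrite (cardsD1 u) leq_add2l; apply/subset_leq_card/subsetP=> y.
  by case/setD1P=> yu /privateP[yX _ yv _ _]; rewrite !inE yX yu sedge_sym yv.
have P3 := cert.2 v vC.
split.
- by move=> i j /eqP; rewrite nth_uniq // => /eqP /ord_inj.
- by move=> i; have := wK i; rewrite !inE => /andP[].
- apply/setP=> y; rewrite in_setU1 inE; have [->|yu] := eqVneq y u; first by rewrite vu.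
  apply/idP/imsetP => [vy|[i _ ->]] /=.
    by have [|i <-] := Kw y; [rewrite !inE yu | exists i].
  by have := wK i; rewrite !inE => /andP[].
exists l; split.
- by rewrite szk leq_addr andbT; case: (u \in _) Pl P3 => /=; lia.
- by move=> i /lo wX; rewrite compX; apply/setIidPl; rewrite sub1set.
- move=> i /hi wX; rewrite compX; apply/setP=> y; rewrite !inE.
  by case: eqP => // ->; apply/negbTE.
case: (boolP (u \in private X C v)) Pl => [/privateP[uX _ _ _ _]|_] /= Pl.
  case: (ltngtP l 2) => [|l3|l2]; first by lia.
    by right; split.
  by left; split.
by right; split=> //; lia.
Qed.

End DeepestCenter.

Lemma calT_transport (H G : sgraph) (f : H -> G) (X1 Y1 : {set H}) (X Y : {set G}) :
  bijective f -> (forall a b, sedge (f a) (f b) = sedge a b) ->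
  (forall a, (f a \in X) = (a \in X1)) -> (forall a, (f a \in Y) = (a \in Y1)) ->
  calT (Triple X1 Y1) -> calT (Triple X Y).
Proof.
move=> bij_f f_edge fX fY; apply: calT_iso; exists f => /=; have [h fK hK] := bij_f.
by split=> //; apply/setP=> y; rewrite -[y]hK mem_imset ?fX ?fY //; apply: bij_inj.
Qed.

(** * Restoring a deleted leaf or star up to isomorphism *)

Section Extensions.

Variables (G : sgraph) (X Y : {set G}).

Lemma calT_leaf (x : G) (z : induced (~: [set x])) (X1 Y1 : {set add_leaf z}) :
  nbh x = [set embed z] ->
  (forall a, (embed a \in X) = (Some a \in X1)) -> (x \in X) = (None \in X1) ->
  (forall a, (embed a \in Y) = (Some a \in Y1)) -> (x \in Y) = (None \in Y1) ->
  calT (Triple X1 Y1) -> calT (Triple X Y).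
Proof.
move=> nbx XS XN YS YN; have emb_x (a : induced (~: [set x])) : embed a != x.
  by have := embed_in a; rewrite !inE.
have xE y : sedge x y = (y == embed z) by have /setP/(_ y) := nbx; rewrite !inE.
pose f (a : add_leaf z) : G := if a is Some y then embed y else x.
apply: (@calT_transport _ _ f) => [|a b|[]|[]] //.
  apply: inj_card_bij => [[a|] [b|]|] //=.
  - by move/embed_inj->.
  - by move/eqP; rewrite (negPf (emb_x a)).
  - by move/esym/eqP; rewrite (negPf (emb_x b)).
  by rewrite card_option card_induced cardsC1; case: #|G|.
case: a b => [a|] [b|] //=; rewrite ?sedge_irr ?xE ?(inj_eq (@embed_inj _ _)) //.
by rewrite sedge_sym xE (inj_eq (@embed_inj _ _)).
Qed.

Lemma calT_star n (v : G) (w : 'I_n -> G)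
    (u : induced (~: (v |: [set w i | i : 'I_n]))) (X1 Y1 : {set add_star u n}) :
  injective w -> nbh v = embed u |: [set w i | i : 'I_n] ->
  (forall i, nbh (w i) = [set v]) ->
  (forall a, (embed a \in X) = (inl a \in X1)) -> (v \in X) = (inr None \in X1) ->
  (forall i, (w i \in X) = (inr (Some i) \in X1)) ->
  (forall a, (embed a \in Y) = (inl a \in Y1)) -> (v \in Y) = (inr None \in Y1) ->
  (forall i, (w i \in Y) = (inr (Some i) \in Y1)) ->
  calT (Triple X1 Y1) -> calT (Triple X Y).
Proof.
move=> w_inj nbv nbw XO Xv Xw YO Yv Yw.
have wE i y : sedge (w i) y = (y == v) by have /setP/(_ y) := nbw i; rewrite !inE.
have w_v i : w i != v.
  by apply/eqP=> ewv; have := wE i v; rewrite ewv sedge_irr eqxx.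
have embE (a : induced (~: (v |: [set w i | i : 'I_n]))) : embed a != v /\ forall i, embed a != w i.
  have := embed_in a; rewrite in_setC in_setU1 negb_or => /andP[-> /imsetP nw].
  by split=> // i; apply/eqP=> ea; apply: nw; exists i.
have vE a : sedge v (embed a) = (a == u).
  have /setP/(_ (embed a)) := nbv; rewrite inE in_setU1 (inj_eq (@embed_inj _ _)) => ->.
  by case: imsetP => [[i _ ea]|]; [have := (embE a).2 i; rewrite ea eqxx | rewrite orbF].
pose f (a : add_star u n) : G :=
  match a with inl y => embed y | inr None => v | inr (Some i) => w i end.
apply: (@calT_transport _ _ f) => [|a b|[a|[i|]]|[a|[i|]]]; rewrite /f ?XO ?Xw ?YO ?Yw //.
  apply: inj_card_bij => [[a|[i|]] [b|[j|]]|] //=.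
  - by move/embed_inj->.
  - by move/eqP; rewrite (negPf ((embE a).2 j)).
  - by move/eqP; rewrite (negPf (embE a).1).
  - by move/esym/eqP; rewrite (negPf ((embE b).2 i)).
  - by move/w_inj->.
  - by move/eqP; rewrite (negPf (w_v i)).
  - by move/esym/eqP; rewrite (negPf (embE b).1).
  - by move/esym/eqP; rewrite (negPf (w_v j)).
  rewrite card_sum card_option card_ord card_induced.
  rewrite -(cardsC (v |: [set w i | i : 'I_n])) addnC leq_add2l.
  by apply: leq_trans (leq_card_setU _ _) _; rewrite cards1 add1n ltnS card_imset ?card_ord.
have wv i : sedge v (w i) by rewrite sedge_sym wE.
case: a b => [a|[i|]] [b|[j|]] //=; rewrite ?sedge_irr ?wE ?wv ?vE //.
- by rewrite sedge_sym wE; apply/negbTE; case: (embE a).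
- by rewrite sedge_sym vE.
- by apply/negbTE; case: (embE b).
- exact/negbTE.
by rewrite eqxx.
Qed.

End Extensions.

(** * Induction on the number of vertices *)

Section Induction.

Variables (G : sgraph) (r : G) (d : G -> nat) (X C : {set G}).
Hypothesis root : rooted r d.
Hypothesis cert : certificate X C.
Hypothesis IH : forall (H : sgraph) (X Y : {set H}), #|H| < #|G| ->
  certified (Triple X Y) -> calT (Triple X Y).

Let dE := root.1.1.
Let dU := root.1.2.

Lemma nbh_single x z : sedge x z -> (forall y, sedge x y -> ~~ (d x < d y)) ->
  d z < d x /\ nbh x = [set z].
Proof.
move=> xz leaf; have lower y : sedge x y -> d y < d x.
  by move=> xy; rewrite ltn_neqAle eq_sym dE // leqNgt leaf.
split; first exact: lower.
apply/setP=> y; rewrite !inE; apply/idP/eqP => [xy|->//].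
by apply: (dU xy xz); apply: lower.
Qed.

(** * Removing a leaf outside [C] *)

Section Leaf.

Variables (x z : G).
Hypotheses (xr : x != r) (nbx : nbh x = [set z]) (xC : x \notin C).
Hypothesis priv : forall v, v \in C -> 2 < #|private X C v :&: ~: [set x]|.

Let H := induced (~: [set x]).
Let X0 : {set H} := @embed G _ @^-1: X.
Let C0 : {set H} := @embed G _ @^-1: C.

Let xE y : sedge x y = (y == z).
Proof. by have /setP/(_ y) := nbx; rewrite !inE. Qed.

Let xz : sedge x z. Proof. by rewrite xE. Qed.

Let CA : C \subset ~: [set x].
Proof. by apply/subsetP=> c cC; rewrite !inE; apply: contraNneq xC => <-. Qed.

Let cert0 : certificate X0 C0.
Proof.
by apply: induced_certificate => //; apply: subset_trans cert.1; apply: subsetIl.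
Qed.

Let inH y : y != x -> exists y' : H, embed y' = y.
Proof. by move=> yx; apply: embedP; rewrite !inE. Qed.

Let rootH (r' : H) : embed r' = r -> rooted r' (d \o @embed G _).
Proof.
move=> er'; apply: induced_rooted => [|a y ax ay lt]; first by rewrite er'.
rewrite !inE; apply: contraTneq lt => ey; rewrite -leqNgt ey.
have [y' xy' lty'] := root.2 x xr; move: xy' lty'; rewrite xE => /eqP->.
have -> : a = z by apply/eqP; rewrite -xE -ey sedge_sym.
exact: ltnW.
Qed.

Let treeH : is_tree H.
Proof.
have [|r' er'] := inH (y := r); first by rewrite eq_sym.
exact: rooted_tree (rootH er').
Qed.

Let calT0 : calT (Triple X0 (closed_nbh C0)).
Proof.
apply: IH; last by split=> //; right; exists C0.
by rewrite card_induced cardsC1 ltn_predL; apply/card_gt0P; exists x.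
Qed.

Let calT_step t : operation X0 (closed_nbh C0) t -> calT t.
Proof. by apply: calT_op calT0 treeH cert0.1. Qed.

Let embX a : (embed a \in X) = (a \in X0).
Proof. by rewrite mem_preimset. Qed.

Let embY a : (embed a \in closed_nbh C) = (a \in closed_nbh C0).
Proof. by rewrite induced_closed_nbh ?mem_preimset. Qed.

(** Common to Operations 1 and 5, where the new leaf enters neither [X] nor [Y]. *)
Lemma calT_pendant (z' : H) : embed z' = z ->
  calT (Triple (old_leaf z' @: X0) (old_leaf z' @: closed_nbh C0)) ->
  x \notin closed_nbh C -> calT (Triple X (closed_nbh C)).
Proof.
move=> ez T xY; have xX : x \notin X by apply: contra xY; apply: (subsetP cert.1).
have oN := old_leaf_None z'.
apply: calT_leaf T; rewrite ?ez ?nbx ?(negPf xY) ?(negPf xX) ?oN // => a.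
  by rewrite old_leaf_Some embX.
by rewrite old_leaf_Some embY.
Qed.

Let zx : z != x. Proof. by apply: contraTneq xz => ->; rewrite sedge_irr. Qed.

Let pendant_far : z \notin C -> x \notin closed_nbh C.
Proof.
move=> zC; apply/closed_nbhP=> -[|[c cC]]; first exact/negP.
by rewrite xE => /eqP ecz; rewrite -ecz cC in zC.
Qed.

Lemma calT_operation1 : z \notin closed_nbh C -> calT (Triple X (closed_nbh C)).
Proof.
move=> zY; have [z' ez] := inH zx; apply: (calT_pendant ez); last first.
  by apply: pendant_far; apply: contra zY => zC; apply/closed_nbhP; left.
by apply: calT_step; apply: Operation1; rewrite -embY ez.
Qed.

Variable v : G.
Hypotheses (vC : v \in C) (vr : v != r) (deepest : forall c, c \in C -> d c <= d v).

Let v_x : v != x. Proof. by apply: contraNneq xC => <-. Qed.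

(** Levels in the smaller tree are inherited from [G], so [v] remains a deepest vertex of the
    certificate there. *)
Let config0 (v' : H) : embed v' = v -> exists u k (w : 'I_k -> H),
  config X0 (closed_nbh C0) v' u w /\
  forall y : H, sedge v' y -> d v < d (embed y) -> exists i, w i = y.
Proof.
move=> ev; have [|r' er'] := inH (y := r); first by rewrite eq_sym.
have [|||u [k [w [conf wP]]]] := config_deepest (rootH er') cert0 (v := v').
- by rewrite mem_preimset ev.
- by move=> c; rewrite mem_preimset /= ev; apply: deepest.
- by apply: contraNneq vr => ev'; rewrite -ev ev' er'.
by exists u, k, w; split=> // y vy; rewrite -ev; apply: wP.
Qed.

Lemma calT_operation4 : z = v -> calT (Triple X (closed_nbh C)).
Proof.
move=> zv; have [v' ev] := inH v_x; have [u [k [w [conf _]]]] := config0 ev.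
have xY : x \in closed_nbh C by apply/closed_nbhP; right; exists v; rewrite // -zv.
have step X1 : X1 = old_leaf v' @: X0 \/ X1 = new_leaf v' |: old_leaf v' @: X0 ->
    calT (Triple X1 (new_leaf v' |: old_leaf v' @: closed_nbh C0)).
  by move=> X1E; apply: calT_step; apply: Operation4 conf X1E.
have nbx' : nbh x = [set embed v'] by rewrite ev -zv.
case: (boolP (x \in X)) => xX.
  apply: calT_leaf (step _ (or_intror erefl)); rewrite ?nbx' ?xX ?xY ?setU11 // => a.
    by rewrite in_setU1 old_leaf_Some embX.
  by rewrite in_setU1 old_leaf_Some embY.
apply: calT_leaf (step _ (or_introl erefl));
  rewrite ?nbx' ?(negPf xX) ?xY ?setU11 ?old_leaf_None // => a.
  by rewrite old_leaf_Some embX.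
by rewrite in_setU1 old_leaf_Some embY.
Qed.

Lemma calT_operation5 : sedge v z -> d v < d z -> calT (Triple X (closed_nbh C)).
Proof.
move=> vz lt; have zC : z \notin C by apply: contraTN lt => /deepest; rewrite -leqNgt.
have [v' ev] := inH v_x; have [u [k [w [conf wP]]]] := config0 ev.
have [z' ez] := inH zx; have [||i ei] := wP z'; rewrite ?ez //.
  by rewrite -ev -ez in vz.
rewrite -ei in ez; apply: (calT_pendant ez); last exact: pendant_far.
by apply: calT_step; apply: Operation5 conf.
Qed.

End Leaf.

Lemma root_le x : d r <= d x.
Proof.
have [n] := ubnP (d x); elim: n x => // n IHn x lt_n.
have [-> // | /root.2[y _ lty]] := eqVneq x r.
by have := IHn y; lia.
Qed.

(** * Removing a deepest vertex of [C] together with its children *)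

Section Star.

Variables (v u : G) (n : nat) (w : 'I_n -> G).
Hypotheses (vC : v \in C) (vr : v != r) (deepest : forall c, c \in C -> d c <= d v).
Hypotheses (ltu : d u < d v) (w_inj : injective w).
Hypothesis nbv : nbh v = u |: [set w i | i : 'I_n].
Hypotheses (w_neq_u : forall i, w i != u) (nbw : forall i, nbh (w i) = [set v]).
Hypothesis wX : forall i, w i \in X.

Let W := v |: [set w i | i : 'I_n].
Let H := induced (~: W).
Let C1 := C :\ v.
(** The vertex [u] leaves [X], since [v] may have been its only neighbor in [C]; the operation can
    put it back. *)
Let X0 : {set H} := @embed G _ @^-1: (X :\ u).
Let C0 : {set H} := @embed G _ @^-1: C1.

Let wE i y : sedge (w i) y = (y == v).
Proof. by have /setP/(_ y) := nbw i; rewrite !inE. Qed.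

Let vE y : sedge v y = (y == u) || (y \in [set w i | i : 'I_n]).
Proof. by have /setP/(_ y) := nbv; rewrite inE in_setU1. Qed.

Let vu : sedge v u. Proof. by rewrite vE eqxx. Qed.

Let ltw i : d v < d (w i).
Proof.
have vw : sedge v (w i) by rewrite sedge_sym wE.
case: (ltngtP (d v) (d (w i))) (dE vw) => // lt _.
by have := w_neq_u i; rewrite (dU vw vu lt ltu) eqxx.
Qed.

Let wC i : w i \notin C.
Proof. by apply: contraTN (ltw i) => /deepest; rewrite -leqNgt. Qed.

Let inW y : y \in W -> y = v \/ exists i, y = w i.
Proof. by rewrite in_setU1 => /predU1P[|/imsetP[i _]]; [left | right; exists i]. Qed.

Let C1_out : C1 \subset ~: W.
Proof.
apply/subsetP=> c /setD1P[cv cC]; rewrite in_setC; apply/negP=> /inW[ecv|[i ec]].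
  by rewrite ecv eqxx in cv.
by have := wC i; rewrite -ec cC.
Qed.

Let u_out : u \in ~: W.
Proof.
rewrite in_setC; apply/negP=> /inW[euv|[i eu]]; first by have := ltu; rewrite euv ltnn.
by have := w_neq_u i; rewrite eu eqxx.
Qed.

Let closed_nbh_out y : y \notin W -> y \in closed_nbh C = (y == u) || (y \in closed_nbh C1).
Proof.
move=> yW; have yv : y != v by apply: contraNneq yW => ->; apply: setU11.
apply/closed_nbhP/predU1P => [[yC|[c cC yc]]|[->|]].
- by right; apply/closed_nbhP; left; rewrite in_setD1 yv.
- have [ecv|cv] := eqVneq c v; last first.
    by right; apply/closed_nbhP; right; exists c; rewrite // in_setD1 cv.
  move: yc; rewrite ecv sedge_sym vE => /predU1P[->|yw]; first by left.
  by rewrite in_setU1 yw orbT in yW.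
- by right; exists v; rewrite // sedge_sym.
by case/closed_nbhP=> [/setD1P[_]|[c /setD1P[_ cC]]]; [left | right; exists c].
Qed.

(** A private neighbor of some [c] other than [v] is not adjacent to [v], so it is neither [u] nor
    one of the [w i], and it survives. *)
Let cert0 : certificate X0 C0.
Proof.
apply: induced_certificate => //.
  apply/subsetP=> y /setIP[/setD1P[yu yX]]; rewrite in_setC => yW.
  by have := subsetP cert.1 y yX; rewrite closed_nbh_out // (negPf yu).
move=> c /setD1P[cv cC]; apply: leq_trans (cert.2 c cC) _.
apply/subset_leq_card/subsetP=> y /privateP[yX yC yc _ unc].
have yv : ~~ sedge y v by apply: contra cv => yv; rewrite (unc v).
apply/setIP; split; last first.
  rewrite in_setC; apply/negP=> /inW[eyv|[i ey]]; first by rewrite eyv vC in yC.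
  by rewrite ey wE eqxx in yv.
apply/privateP; split=> //; rewrite ?in_setD1 ?cv ?(negPf yC) ?andbF //.
  by rewrite yX andbT; apply: contraNneq yv => ->; rewrite sedge_sym.
by move=> b /setD1P[_ bC]; apply: unc.
Qed.

Let treeH : is_tree H.
Proof.
have [|r' er'] := @embedP _ (~: W) r.
  rewrite in_setC; apply/negP=> /inW[erv|[i er]]; first by have := vr; rewrite erv eqxx.
  by have := root_le v; have := ltw i; rewrite -er; lia.
apply: (@rooted_tree _ r' (d \o @embed G _)); apply: induced_rooted; rewrite ?er' //.
move=> a y; rewrite !in_setC => aW ay lt; apply/negP=> /inW[ey|[i ey]].
  move: ay lt; rewrite ey sedge_sym vE => /predU1P[->|aw]; first by lia.
  by rewrite in_setU1 aw orbT in aW.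
by rewrite sedge_sym ey wE in ay; rewrite (eqP ay) setU11 in aW.
Qed.

Let calT0 : calT (Triple X0 (closed_nbh C0)).
Proof.
apply: IH; last by split=> //; right; exists C0.
rewrite card_induced -[ltnRHS]cardsT; apply/proper_card/properP.
by split; [apply: subsetT | exists v; rewrite ?inE ?eqxx].
Qed.

(** The part shared by Operations 2 and 3. The conditionals in [X'] select the variant that agrees
    with [X] at [u] and [v]. *)
Lemma calT_star_step :
  (forall (u' : H) (X' : {set add_star u' n}),
     embed u' = u -> u' \notin X0 -> (u \notin closed_nbh C1 -> u' \notin closed_nbh C0) ->
     X' = old_star u' n @: (if u \in X then u' |: X0 else X0) :|:
          (if v \in X then center u' n |: rays u' n else rays u' n) ->
     operation X0 (closed_nbh C0) (Triple X'
       (old_star u' n @: (u' |: closed_nbh C0) :|: (center u' n |: rays u' n)))) ->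
  calT (Triple X (closed_nbh C)).
Proof.
move=> op; have [u' eu] := embedP u_out.
have XO a : (a \in X0) = (embed a != u) && (embed a \in X) by rewrite mem_preimset in_setD1.
have YO a : (a \in closed_nbh C0) = (embed a \in closed_nbh C1).
  by rewrite induced_closed_nbh ?mem_preimset.
have a_u a : (a == u') = (embed a == u) by rewrite -eu (inj_eq (@embed_inj _ _)).
have uX0 : u' \notin X0 by rewrite XO eu eqxx.
have uY0 : u \notin closed_nbh C1 -> u' \notin closed_nbh C0 by rewrite YO eu.
have T := calT_op calT0 treeH cert0.1 (op u' _ eu uX0 uY0 erefl).
have vY : v \in closed_nbh C by apply/closed_nbhP; left.
have wY i : w i \in closed_nbh C.
  by apply/closed_nbhP; right; exists v; rewrite // wE.
apply: (calT_star w_inj _ nbw) T => [|a||i|a||i].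
- by rewrite eu.
- rewrite in_setU old_star_inl; case: ifP => uX; case: ifP => _;
    rewrite ?in_setU1 ?rays_inl ?orbF ?a_u XO //=; by case: eqP => // ->.
- by rewrite in_setU old_star_inr; case: ifP; rewrite ?setU11 ?rays_center.
- by rewrite wX in_setU; case: (v \in X); rewrite ?in_setU1 rays_Some ?orbT.
- rewrite in_setU old_star_inl in_setU1 in_setU1 rays_inl orbF a_u YO.
  by rewrite orbF closed_nbh_out //; have := embed_in a; rewrite in_setC.
- by rewrite vY in_setU in_setU1 eqxx orbT.
by rewrite wY in_setU in_setU1 rays_Some !orbT.
Qed.

End Star.

Variable v : G.
Hypotheses (vC : v \in C) (vr : v != r) (deepest : forall c, c \in C -> d c <= d v).

(** Since [u] is private to [v], it is outside the closed neighborhood of [C :\ v], as Operation 2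
    requires. *)
Lemma calT_operation2 (u : G) (w : 'I_2 -> G) : d u < d v -> injective w ->
  nbh v = u |: [set w i | i : 'I_2] -> (forall i, w i != u) ->
  (forall i, nbh (w i) = [set v]) -> (forall i, w i \in X) ->
  u \in private X C v -> calT (Triple X (closed_nbh C)).
Proof.
move=> ltu w_inj nbv wu nbw wX /privateP[uX uC _ _ unv].
apply: (calT_star_step vC vr deepest ltu w_inj nbv wu nbw wX) => u' X' _ _ uY ->.
apply: Operation2; last by rewrite uX; case: ifP; [right | left].
apply: uY; apply/closed_nbhP=> -[/setD1P[_]|[c /setD1P[cv cC] uc]]; first exact/negP.
by rewrite (unv c) ?eqxx in cv.
Qed.

Lemma calT_operation3 (u : G) (w : 'I_3 -> G) : d u < d v -> injective w ->
  nbh v = u |: [set w i | i : 'I_3] -> (forall i, w i != u) ->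
  (forall i, nbh (w i) = [set v]) -> (forall i, w i \in X) ->
  calT (Triple X (closed_nbh C)).
Proof.
move=> ltu w_inj nbv wu nbw wX.
apply: (calT_star_step vC vr deepest ltu w_inj nbv wu nbw wX) => u' X' _ uX0 _ ->.
apply: Operation3 uX0 _.
by case: (u \in X); case: (v \in X);
  [constructor 4 | constructor 2 | constructor 3 | constructor 1].
Qed.

(** A deepest proper descendant of a child of [v] is a leaf outside the closed neighborhood of [C];
    Operation 5 or 1 adds it back, according to whether its parent is a child of [v]. If there is
    none, the children are leaves. Operation 4 handles a child outside [X], or any one of more than
    three. There remain two or three children, all in [X], for Operations 2 and 3. *)
Lemma calT_of_deepest : calT (Triple X (closed_nbh C)).
Proof.
have [u vu ltu] := root.2 v vr; pose K := nbh v :\ u.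
have Kup y : y \in K = (sedge v y && (d v < d y)).
  rewrite !inE andbC; case vy: (sedge v y) => //=.
  case: (ltngtP (d v) (d y)) (dE vy) => // lt _.
    by apply: contraTneq ltu => <-; rewrite -leqNgt ltnW.
  by rewrite (dU vy vu lt ltu) eqxx.
have low_r x y : sedge x y -> d y < d x -> x != r.
  by move=> _ lt; apply: contraTneq lt => ->; rewrite -leqNgt root_le.
have desc_priv w y : w \in K -> y \in descendants d w -> y != w -> y \notin closed_nbh C.
  rewrite Kup => /andP[vw ltw] wy yw; apply: contra yw => yY.
  by rewrite -in_set1 -(descendants_closed_nbh root vC deepest vw ltw) in_setI wy.
have self x : x \in C -> x \in closed_nbh C by move=> xC; apply/closed_nbhP; left.
pose E := [set y | [exists w in K, (y \in descendants d w) && (y != w)]].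
have [E0|[y0 y0E]] := set_0Vmem E; last first.
  have [x xE xmax] : exists2 x, x \in E & forall y, y \in E -> d y <= d x.
    by case: (arg_maxnP d y0E) => x; exists x.
  move: xE; rewrite inE => /exists_inP[w wK /andP[wx xw]].
  have [exw|[z wz /andP[zx ltz]]] := descendantsP wx; first by rewrite exw eqxx in xw.
  have leaf b : sedge x b -> ~~ (d x < d b).
    move=> xb; rewrite -leqNgt leqNgt; apply/negP=> lt.
    have bE : b \in E.
      rewrite inE; apply/exists_inP; exists w => //; rewrite (descendants_up wx xb lt) /=.
      by apply: contraTneq lt => ->; rewrite -leqNgt (descendants_le wx).
    by have := xmax b bE; rewrite leqNgt lt.
  have xz : sedge x z by rewrite sedge_sym.
  have [_ nbx] := nbh_single xz leaf; have xr := low_r _ _ xz ltz.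
  have xY := desc_priv _ _ wK wx xw.
  have xC : x \notin C by apply: contra xY; apply: self.
  have priv c : c \in C -> 2 < #|private X C c :&: ~: [set x]|.
    move=> cC; rewrite (setIidPl _); first exact: cert.2.
    apply/subsetP=> y /private_closed_nbh yY; rewrite !inE.
    by apply: contraTneq yY => ->.
  have [ezw|zw] := eqVneq z w.
    move: wK; rewrite -ezw Kup => /andP[vz ltvz].
    exact: (calT_operation5 xr nbx xC priv vC vr deepest vz ltvz).
  exact: (calT_operation1 xr nbx xC priv (desc_priv _ _ wK wz zw)).
have nbK w : w \in K -> nbh w = [set v].
  move=> wK; move: (wK); rewrite Kup => /andP[vw ltw].
  have [||//] := @nbh_single w v; first by rewrite sedge_sym.
  move=> y wy; apply/negP=> lt; have : y \in E.
    rewrite inE; apply/exists_inP; exists w => //.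
    rewrite (descendants_up (descendants_self _ w) wy lt) /=.
    by apply: contraTneq lt => ->; rewrite ltnn.
  by rewrite E0 inE.
have KC w : w \in K -> w \notin C.
  by rewrite Kup => /andP[_ lt]; apply: contraTN lt => /deepest; rewrite -leqNgt.
have step4 x : x \in K -> 2 < #|private X C v :&: ~: [set x]| ->
    calT (Triple X (closed_nbh C)).
  move=> xK p3; have nbx := nbK x xK; have xC := KC x xK.
  move: (xK); rewrite Kup => /andP[vx ltx].
  have xr : x != r by apply: (low_r x v); rewrite // sedge_sym.
  apply: (calT_operation4 xr nbx xC _ vC vr deepest erefl) => c cC.
  (* Only [v] can lose a private neighbor, because [x] is adjacent to nothing else. *)
  have [-> //|cv] := eqVneq c v; rewrite (setIidPl _); first exact: cert.2.
  apply/subsetP=> y /privateP[_ _ yc _ _]; rewrite !inE; apply: contraTneq yc => ->.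
  by have /setP/(_ c) := nbx; rewrite !inE (negPf cv) => ->.
have [KX|/subsetPn[x xK xX]] := boolP (K \subset X); last first.
  apply: (step4 x xK); rewrite (setIidPl _); first exact: cert.2.
  by apply/subsetP=> y /privateP[yX _ _ _ _]; rewrite !inE; apply: contraNneq xX => <-.
have Kpriv : K \subset private X C v.
  apply/subsetP=> w wK; have nw := nbK w wK.
  have wE y : sedge w y = (y == v) by have /setP/(_ y) := nw; rewrite !inE.
  apply/privateP; split; rewrite ?wE ?KC ?(subsetP KX) // => c _.
  by rewrite wE => /eqP.
have privK : #|private X C v| <= (u \in private X C v) + #|K|.
  rewrite (cardsD1 u) leq_add2l; apply/subset_leq_card/subsetP=> y.
  by case/setD1P=> yu /privateP[_ _ yv _ _]; rewrite !inE yu sedge_sym.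
have P3 := cert.2 v vC.
have K2 : 1 < #|K| by case: (u \in _) privK; lia.
have enumK n : #|K| = n -> exists w : 'I_n -> G,
    [/\ injective w, nbh v = u |: [set w i | i : 'I_n] & forall i, w i \in K].
  move=> <-; exists enum_val; split; [exact: enum_val_inj | | exact: enum_valP].
  have -> : [set enum_val i | i : 'I_#|K|] = K.
    apply/setP=> y; apply/imsetP/idP => [[i _ ->]|yK]; first exact: enum_valP.
    by exists (enum_rank_in yK y); rewrite ?enum_rankK_in.
  by rewrite setD1K // inE.
case: (ltngtP #|K| 3) => [K3|K3|/enumK[w [w_inj nbv wK]]].
(* With two children, the third private neighbor of [v] must be its parent [u]. *)
- have /enumK[w [w_inj nbv wK]] : #|K| = 2 by lia.
  apply: (calT_operation2 ltu w_inj nbv) => [i|i|i|].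
  + by have := wK i; rewrite !inE => /andP[].
  + exact: nbK.
  + exact: (subsetP KX).
  by case: (u \in _) privK => //; lia.
- have [x xK] : exists x, x \in K by apply/card_gt0P; lia.
  apply: (step4 x xK); apply: (@leq_trans #|K :\ x|).
    by have := cardsD1 x K; rewrite xK; lia.
  by apply/subset_leq_card; rewrite setDE setSI.
apply: (calT_operation3 ltu w_inj nbv) => [i|i|i].
- by have := wK i; rewrite !inE => /andP[].
- exact: nbK.
exact: (subsetP KX).
Qed.

End Induction.

Lemma certified_calT t : certified t -> calT t.
Proof.
case: t => G X Y; have [n] := ubnP #|G|; elim: n G X Y => // n IHn G X Y lt_n [/= tG].
have IH (H : sgraph) (X' Y' : {set H}) : #|H| < #|G| ->
    certified (Triple X' Y') -> calT (Triple X' Y').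
  by move=> lt; apply: IHn; lia.
have [/card_gt0P[r0 _] _ _] := tG.
have point (Z : {set K1}) (A : {set G}) : #|G| = 1 -> (forall x, (r0 \in A) = (x \in Z)) ->
    (fun _ : K1 => r0) @: Z = A.
  move=> /eqP; rewrite -cardsT => /cards1P[a aT] rA.
  have allr y : y = r0.
    by apply/eqP; have := in_setT y; have := in_setT r0; rewrite !aT !inE => /eqP->.
  apply/setP=> y; rewrite (allr y) (rA tt).
  by apply/imsetP/idP => [[[] ttZ _] //|ttZ]; exists tt.
have iso1 (Z : {set K1}) : #|G| = 1 -> calT (Triple Z Z) ->
    forall A : {set G}, (forall x, (r0 \in A) = (x \in Z)) -> calT (Triple A A).
  move=> G1 TZ A rA; have imA := point Z A G1 rA.
  apply: calT_iso TZ; exists (fun _ : K1 => r0); split=> // [|x y].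
    by exists (fun _ => tt) => [[]|y] //; apply: fintype_le1P; rewrite G1.
  by rewrite sedge_irr.
case=> [[G1 -> ->]|[C cert ->]].
  by apply: (iso1 setT G1 calT_full) => x; rewrite !inE.
have [C0|[v0 v0C]] := set_0Vmem C.
  have Y0 : closed_nbh C = set0.
    apply/setP=> y; rewrite C0 in_set0; apply/closed_nbhP=> -[|[c]]; rewrite in_set0 //.
  have X0 : X = set0 by apply/eqP; rewrite -subset0 -Y0 cert.1.
  have [G1|G1] := eqVneq #|G| 1.
    by rewrite Y0 X0; apply: (iso1 set0 G1 calT_empty) => x; rewrite !inE.
  have [d root] := tree_rooted r0 tG.
  (* With [C] empty, [Y] is empty too, so Operation 1 can add any leaf back; a vertex of maximum
     level is one. *)
  case: (@arg_maxnP _ r0 xpredT d isT) => x _ xmax.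
  have [z xz] := tree_neighbor x tG (elimN eqP G1).
  have [|ltz nbx] := nbh_single root xz; first by move=> y _; rewrite -leqNgt; apply: xmax.
  have xr : x != r0 by apply: contraTneq ltz => ->; rewrite -leqNgt (root_le root).
  apply: (calT_operation1 root cert IH xr nbx); rewrite ?Y0 ?C0 ?inE // => v.
  by rewrite inE.
(* A private neighbor lies outside [C]; rooting the tree there gives every vertex of [C] a
   parent. *)
have [y /privateP[_ yC _ _ _]] : exists y, y \in private X C v0.
  by apply/card_gt0P; have := cert.2 v0 v0C; lia.
have [d root] := tree_rooted y tG.
case: (arg_maxnP d v0C) => v vC vmax.
apply: (calT_of_deepest root cert IH vC) => //.
by apply: contraNneq yC => <-.
Qed.

Theorem theorem6 (t : triple) : calS t <-> calT t.
Proof.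
rewrite calS_certified; split; [exact: certified_calT | exact: calT_certified].
Qed.
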